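(* Let $(M,\tau)$ be a tracial $W^*$-probability space and $B\subset M$ a unital $*$-subalgebra. Consider selfadjoint random variables $X_1,\dots,X_n\in M$ with $\Phi^*(X_1,\dots,X_n:B)<\infty$. Let $D\subset B$ be a unital $*$-subalgebra of $B$ with conditional expectation $E:M\to D$ such that $\tau\circ E=\tau$. Assume that $\dim(D)<\infty$. Then the $D$-valued liberation gradient of the pair $D\langle X_1,\dots,X_n\rangle$ and $B$ exists and is given by $$j_D(D\langle X_1,\dots,X_n\rangle:B)=E_{D'}\Bigl(\sum_{i=1}^n[J_i(X_1,\dots,X_n:B),X_i]\Bigr)\cdot c^{-1}\cdot\dim(D).$$
   Context: A tracial $W^*$-probability space $(M,\tau)$ is a von Neumann algebra $M$ with a faithful normal trace (tracial state) $\tau$. $L^2(S_1,\dots,S_p)$ is the closure, in $\|a\|_{L^2}^2=\tau(aa^* )$, of the von Neumann algebra generated by the $S_i$. A conditional expectation $E:M\to D$ is a unital $D$-bimodule linear map; being $\tau$-preserving it extends to $L^2(M,\tau)$. $D\langle X_1,\dots,X_n\rangle$ is the algebra generated by $D$ and $X_1,\dots,X_n$. Conjugate variables: $J_i=J_i(X_1,\dots,X_n:B)$ are the (unique, if they exist) vectors in $L^2(X_1,\dots,X_n,B)$ with $$\tau(J_ib_1X_{i_1}b_2\cdots b_mX_{i_m}b_{m+1})=\sum_{r=1}^m\delta_{i i_r}\,\tau(b_1X_{i_1}b_2\cdots X_{i_{r-1}}b_r)\,\tau(b_{r+1}X_{i_{r+1}}\cdots b_mX_{i_m}b_{m+1})$$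 for all $m\ge0$, $b_j\in B$, $1\le i_1,\dots,i_m\le n$ (for $m=0$: $\tau(J_ib)=0$). $\Phi^*(X_1,\dots,X_n:B)=\sum_i\|J_i\|_{L^2}^2$ if they exist and $+\infty$ otherwise. Liberation gradient: for subalgebras $D\subset A_1,A_2\subset M$ that are algebraically free modulo $D$ (the canonical map $A_1*_DA_2\to A=A_1\vee A_2$, the algebra generated by both, is injective), $\delta_{A_1:A_2}:A\to A\otimes_DA$ is the derivation with $\delta_{A_1:A_2}(a)=a\otimes1-1\otimes a$ for $a\in A_1$ and $=0$ for $a\in A_2$; $j_D(A_1:A_2)$ is the vector $j\in L^2(A_1,A_2)$ (if it exists) with $E(ja)=(E\otimes E)(\delta_{A_1:A_2}(a))$ for all $a\in A$, where $(E\otimes E)(a\otimes\hat a)=E(a)E(\hat a)$. Here $A_1=D\langle X_1,\dots,X_n\rangle$, $A_2=B$; as in the definition, these are understood to be algebraically free modulo $D$ (with $\mathbb C\langle X_1,\dots,X_n\rangle$ and $B$ algebraically free). Finite-dimensional $D$: let $D\cong M_{n_1}(\mathbb C)\oplus\dots\oplus M_{n_k}(\mathbb C)$ with minimal central projections $p_1,\dots,p_k$; then $c=(n_1^2+\dots+n_k^2)\sum_{j=1}^k\frac{\tau(p_j)}{n_j^2}p_j\in D$. $E_{D'}(\xi)=\int_Uu\xi u^*\,du$ for $\xi\in L^2(M,\tau)$, where $U$ is the compact group of unitaries of $D$ and $du$ its normalized Haar measure. *)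

(* Defs.v *)
From HB Require Import structures.
From mathcomp Require Import all_boot all_order all_algebra.
From mathcomp Require Import complex.
From mathcomp Require Import all_classical all_reals all_analysis.

Set Implicit Arguments.
Unset Strict Implicit.
Unset Printing Implicit Defensive.

Import Order.TTheory GRing.Theory Num.Theory.
Import numFieldNormedType.Exports.

Local Open Scope classical_set_scope.
Local Open Scope ring_scope.
Local Open Scope complex_scope.

(* Linear in the first argument, and inducing the norm: a complete normed
   space with such a form is a Hilbert space. *)
Definition is_inner_product (R : realType) (H : normedModType R[i])
    (dot : H -> H -> R[i]) : Prop :=
  [/\ forall (a : R[i]) (u v w : H), dot (a *: u + v) w = a * dot u w + dot v w,
      forall u v : H, dot v u = (dot u v)^*
    & forall u : H, `|u| ^+ 2 = dot u u].

Definition bounded_operator (R : realType) (H : normedModType R[i])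
    (T : H -> H) : Prop :=
  (forall (a : R[i]) (u v : H), T (a *: u + v) = a *: T u + T v) /\
  (exists k : R[i], forall u : H, `|T u| <= k * `|u|).

(* The set of operators pi x (x in N) is closed in B(H) for the weak operator
   topology: it contains every bounded operator all of whose basic WOT
   neighbourhoods meet it. *)
Definition wot_closed (R : realType) (H : normedModType R[i])
    (dot : H -> H -> R[i]) (M : Type) (pi : M -> H -> H) (N : set M) : Prop :=
  forall T : H -> H, bounded_operator T ->
    (forall (s : seq (H * H)) (e : R[i]), 0 < e ->
       exists2 x, N x &
         forall p, p \in s -> `|dot (pi x p.1 - T p.1) p.2| < e) ->
    exists2 x, N x & pi x = T.

(* A unital *-algebra together with a faithful unital *-representation pi on a
   Hilbert space with WOT-closed range, i.e. a concrete von Neumann algebra.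
   The carrier is a unitAlgType only in order to have the notation x^-1 (every
   algebra is one, classically). *)
Record vonNeumannAlgebra (R : realType) := VonNeumannAlgebra {
  vn_alg :> unitAlgType R[i];
  star : vn_alg -> vn_alg;
  starK : forall x, star (star x) = x;
  star_antilinear : forall (a : R[i]) x y,
    star (a *: x + y) = a^* *: star x + star y;
  starM : forall x y, star (x * y) = star y * star x;
  vn_H : completeNormedModType R[i];
  vn_dot : vn_H -> vn_H -> R[i];
  vn_dotP : is_inner_product vn_dot;
  vn_pi : vn_alg -> vn_H -> vn_H;
  vn_pi_bounded : forall x, bounded_operator (vn_pi x);
  vn_pi_linear : forall (a : R[i]) x y u,
    vn_pi (a *: x + y) u = a *: vn_pi x u + vn_pi y u;
  vn_pi1 : forall u, vn_pi 1 u = u;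
  vn_piM : forall x y u, vn_pi (x * y) u = vn_pi x (vn_pi y u);
  vn_pi_star : forall x u v, vn_dot (vn_pi x u) v = vn_dot u (vn_pi (star x) v);
  vn_pi_inj : injective vn_pi;
  vn_closed : wot_closed vn_dot vn_pi setT
}.
Arguments vn_dot {R} _.
Arguments vn_pi {R} _.

(* x is a positive operator; on a complex Hilbert space this entails that x is
   selfadjoint *)
Definition positive (R : realType) (M : vonNeumannAlgebra R) (x : M) : Prop :=
  forall u : vn_H M, 0 <= vn_dot M (vn_pi M x u) u.

Definition is_sup (R : realType) (M : vonNeumannAlgebra R) (S : set M) (x : M)
  : Prop :=
  (forall s, S s -> positive (x - s)) /\
  (forall y, (forall s, S s -> positive (y - s)) -> positive (y - x)).

Definition directed (R : realType) (M : vonNeumannAlgebra R) (S : set M)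
  : Prop :=
  (exists s, S s) /\
  forall s t, S s -> S t ->
    exists r, [/\ S r, positive (r - s) & positive (r - t)].

(* Normality: tau (sup S) = sup (tau S) for every upward directed set S of
   positive elements having a supremum x; tau s <= tau x is automatic. *)
Record tracialWstar (R : realType) := TracialWstar {
  tw_vn :> vonNeumannAlgebra R;
  tau : tw_vn -> R[i];
  tau_linear : forall (a : R[i]) x y, tau (a *: x + y) = a * tau x + tau y;
  tau1 : tau 1 = 1;
  tau_positive : forall x, positive x -> 0 <= tau x;
  tau_trace : forall x y, tau (x * y) = tau (y * x);
  tau_faithful : forall x, positive x -> tau x = 0 -> x = 0;
  tau_normal : forall (S : set tw_vn) x,
    (forall s, S s -> positive s) -> directed S -> is_sup S x ->
    forall e : R[i], 0 < e -> exists2 s, S s & tau x - e < tau s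
}.

(* L^2(M, tau): a Hilbert space containing a dense copy (under L2emb) of M
   with the inner product <x, y> = tau (x y^* ). Any two are isomorphic. *)
Record L2space (R : realType) (M : tracialWstar R) := L2Space {
  L2 :> completeNormedModType R[i];
  L2dot : L2 -> L2 -> R[i];
  L2dotP : is_inner_product L2dot;
  L2emb : M -> L2;
  L2emb_linear : forall (a : R[i]) x y,
    L2emb (a *: x + y) = a *: L2emb x + L2emb y;
  L2emb_dot : forall x y, L2dot (L2emb x) (L2emb y) = tau (x * star y);
  L2emb_dense : closure (range L2emb) = setT
}.
Arguments L2dot {R M} _.
Arguments L2emb {R M} _.

Section Extension.
Variables (R : realType) (M : tracialWstar R) (L : L2space M).

(* the value at xi of the extension by continuity of f : M -> V to L^2,
   i.e. the limit of f x as x in M tends to xi in L^2 *)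
Definition ext (V : normedModType R[i]) (f : M -> V) (xi : L) : V :=
  lim (f x @[x --> filter_from (nbhs xi) (fun O => L2emb L @^-1` O)]).

Definition lact (a : M) : L -> L := ext (fun x => L2emb L (a * x)).
Definition ract (xi : L) (a : M) : L := ext (fun x => L2emb L (x * a)) xi.
Definition tau2 (xi : L) : R[i] := ext (V := R[i]^o) (@tau R M) xi.
Definition E2 (E : M -> M) : L -> L := ext (fun x => L2emb L (E x)).

Definition comm2 (xi : L) (x : M) : L := ract xi x - lact x xi.

End Extension.

Section Subalgebras.
Variables (R : realType) (M : tracialWstar R).

Definition subalgebra (A : set M) : Prop :=
  [/\ A 1, forall (a : R[i]) x y, A x -> A y -> A (a *: x + y)
    & forall x y, A x -> A y -> A (x * y)].

Definition star_subalgebra (A : set M) : Prop :=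
  subalgebra A /\ forall x, A x -> A (star x).

Definition gen_alg (S : set M) : set M :=
  [set x | forall A : set M, subalgebra A -> S `<=` A -> A x].

Definition gen_vN (S : set M) : set M :=
  [set x | forall N : set M,
     star_subalgebra N -> wot_closed (vn_dot M) (vn_pi M) N -> S `<=` N -> N x].

Definition L2gen (L : L2space M) (S : set M) : set L :=
  closure (L2emb L @` gen_vN S).

Definition scalars : set M := [set a%:A | a in [set: R[i]]].

Definition cond_exp (D : set M) (E : M -> M) : Prop :=
  [/\ forall x, D (E x),
      E 1 = 1,
      forall (a : R[i]) x y, E (a *: x + y) = a *: E x + E y
    & forall d x d', D d -> D d' -> E (d * x * d') = d * E x * d'].

End Subalgebras.
Arguments L2gen {R M} _ _ _.

Section ConjugateVariables.
Variables (R : realType) (M : tracialWstar R) (L : L2space M).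
Variables (n : nat) (X : 'I_n -> M) (B : set M).

(* b_l X_(k_l) b_(l+1) X_(k_(l+1)) ... b_(h-1) X_(k_(h-1)) b_h *)
Definition word (b : nat -> M) (k : nat -> 'I_n) (l h : nat) : M :=
  (\prod_(l <= t < h) (b t * X (k t))) * b h.

(* The indices of b and k are shifted to start at 0; only b_0, ..., b_m and
   k_0, ..., k_(m-1) occur. *)
Definition is_conj_vars (J : 'I_n -> L) : Prop :=
  forall i, L2gen L (range X `|` B) (J i) /\
    forall (m : nat) (b : nat -> M) (k : nat -> 'I_n), (forall t, B (b t)) ->
      tau2 (ract (J i) (word b k 0 m)) =
      \sum_(0 <= r < m | k r == i)
        tau (word b k 0 r) * tau (word b k r.+1 m).

Definition conj_vars : 'I_n -> L := xget (fun=> 0) is_conj_vars.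

(* The value does not depend on the choice made in conj_vars, as conjugate
   variables are unique when they exist. *)
Definition free_fisher : \bar R :=
  if `[< exists J, is_conj_vars J >]
  then (\sum_(i < n) complex.Re (`|conj_vars i| ^+ 2))%:E else +oo%E.

End ConjugateVariables.

Section AmalgamatedFreeness.
Variables (R : realType) (M : tracialWstar R).

Definition hom_on (T P : algType R[i]) (A : set T) (f : T -> P) : Prop :=
  [/\ f 1 = 1,
      forall (a : R[i]) x y, A x -> A y -> f (a *: x + y) = a *: f x + f y
    & forall x y, A x -> A y -> f (x * y) = f x * f y].

(* (P, i1, i2) is the algebraic free product of A1 and A2 amalgamated over
   their common subalgebra D (only the values of i_k on A_k matter) *)
Definition is_amalgam (D A1 A2 : set M) (P : algType R[i]) (i1 i2 : M -> P)
  : Prop :=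
  [/\ hom_on A1 i1, hom_on A2 i2, forall x, D x -> i1 x = i2 x
    & forall (Q : algType R[i]) (f1 f2 : M -> Q),
        hom_on A1 f1 -> hom_on A2 f2 -> (forall x, D x -> f1 x = f2 x) ->
        exists! g : P -> Q,
          [/\ hom_on setT g, forall x, A1 x -> g (i1 x) = f1 x
            & forall x, A2 x -> g (i2 x) = f2 x]].

(* the canonical map A1 *_D A2 -> M is injective *)
Definition alg_free (D A1 A2 : set M) : Prop :=
  exists (P : algType R[i]) (i1 i2 : M -> P) (phi : P -> M),
    [/\ is_amalgam D A1 A2 i1 i2, hom_on setT phi,
        forall x, A1 x -> phi (i1 x) = x, forall x, A2 x -> phi (i2 x) = x
      & injective phi].

End AmalgamatedFreeness.

Section LiberationGradient.
Variables (R : realType) (M : tracialWstar R) (L : L2space M).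

(* An element of the D-bimodule tensor product of A with itself over D is
   represented by a formal sum of elementary tensors,
   [:: (x1, y1); ...; (xr, yr)] standing for x1 (x) y1 + ... + xr (x) yr. *)
Definition tensor := seq (M * M).

Definition tensor_in (A : set M) (s : tensor) : Prop :=
  forall p, p \in s -> A p.1 /\ A p.2.

Definition balanced (D A : set M) (Z : zmodType) (b : M -> M -> Z) : Prop :=
  [/\ forall x x' y, A x -> A x' -> A y -> b (x + x') y = b x y + b x' y,
      forall x y y', A x -> A y -> A y' -> b x (y + y') = b x y + b x y'
    & forall x d y, A x -> D d -> A y -> b (x * d) y = b x (d * y)].

(* Equality in A (x)_D A: by the universal property of the tensor product, two
   formal sums are equal there iff no D-balanced biadditive map on A x A
   separates them. *)
Definition tensor_eq (D A : set M) (s t : tensor) : Prop :=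
  forall (Z : zmodType) (b : M -> M -> Z), balanced D A b ->
    \sum_(p <- s) b p.1 p.2 = \sum_(p <- t) b p.1 p.2.

(* a (x (x) y) = (a x) (x) y and (x (x) y) a = x (x) (y a); scalars act through
   a%:A on the left. *)
Definition tlact (a : M) (s : tensor) : tensor := [seq (a * p.1, p.2) | p <- s].
Definition tract (s : tensor) (a : M) : tensor := [seq (p.1, p.2 * a) | p <- s].
Definition tscale (c : R[i]) (s : tensor) : tensor := tlact c%:A s.

Definition is_liberation_derivation (D A1 A2 : set M) (delta : M -> tensor)
  : Prop :=
  let A := gen_alg (A1 `|` A2) in
  [/\ forall a, A a -> tensor_in A (delta a),
      forall (c : R[i]) a b, A a -> A b ->
        tensor_eq D A (delta (c *: a + b)) (tscale c (delta a) ++ delta b),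
      forall a b, A a -> A b ->
        tensor_eq D A (delta (a * b))
                      (tract (delta a) b ++ tlact a (delta b)),
      forall a, A1 a -> tensor_eq D A (delta a) [:: (a, 1); (- 1, a)]
    & forall a, A2 a -> tensor_eq D A (delta a) [::]].

Definition EE (E : M -> M) (s : tensor) : M := \sum_(p <- s) E p.1 * E p.2.

Definition is_liberation_gradient (D A1 A2 : set M) (E : M -> M) (j : L)
  : Prop :=
  L2gen L (A1 `|` A2) j /\
  exists2 delta, is_liberation_derivation D A1 A2 delta &
    forall a, gen_alg (A1 `|` A2) a ->
      E2 E (ract j a) = L2emb L (EE E (delta a)).

End LiberationGradient.

Section FiniteDimensional.
Variables (R : realType) (M : tracialWstar R) (D : set M).

Definition has_dim (N : nat) : Prop :=
  exists e : 'I_N -> M, (forall i, D (e i)) /\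
    forall x, D x -> exists! a : {ffun 'I_N -> R[i]}, x = \sum_i a i *: e i.

(* phi is a *-isomorphism of M_(n_1)(C) (+) ... (+) M_(n_k)(C) onto D *)
Definition is_block_iso (k : nat) (n : 'I_k -> nat)
    (phi : (forall j, 'M[R[i]]_(n j)) -> M) : Prop :=
  [/\ forall j, (0 < n j)%N,
      phi (fun=> 1%:M) = 1 /\
      (forall (a : R[i]) U V,
         phi (fun j => a *: U j + V j) = a *: phi U + phi V),
      (forall U V, phi (fun j => U j *m V j) = phi U * phi V) /\
      (forall U, phi (fun j => map_mx Num.conj (U j)^T) = star (phi U)),
      injective phi
    & range phi = D].

(* the minimal central projections of D *)
Definition block_proj (k : nat) (n : 'I_k -> nat)
    (phi : (forall j, 'M[R[i]]_(n j)) -> M) (j : 'I_k) : M :=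
  phi (fun l => ((l == j)%:R)%:M).

Definition block_c (k : nat) (n : 'I_k -> nat)
    (phi : (forall j, 'M[R[i]]_(n j)) -> M) : M :=
  (\sum_j n j ^ 2)%N%:R *:
    \sum_j (tau (block_proj phi j) / (n j ^ 2)%N%:R) *: block_proj phi j.

End FiniteDimensional.

(* M with the sigma-algebra generated by the L^2-open sets. On the
   finite-dimensional algebra D the L^2-topology is the usual one, so that the
   trace of this sigma-algebra on the unitary group of D is the Borel one. *)
Definition L2measurable (R : realType) (M : tracialWstar R) (L : L2space M)
  : Type := M.
HB.instance Definition _ (R : realType) (M : tracialWstar R) (L : L2space M) :=
  Choice.on (L2measurable L).
HB.instance Definition _ (R : realType) (M : tracialWstar R) (L : L2space M) :=
  isPointed.Build (L2measurable L) (1 : M).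
Definition L2borel (R : realType) (M : tracialWstar R) (L : L2space M)
  : set (set (L2measurable L)) :=
  [set L2emb L @^-1` O | O in [set O : set L | open O]].
Definition borelM (R : realType) (M : tracialWstar R) (L : L2space M) :=
  g_sigma_algebraType (@L2borel R M L).

Section Averaging.
Variables (R : realType) (M : tracialWstar R) (L : L2space M) (D : set M).

Definition unitary_group : set M :=
  [set u | [/\ D u, star u * u = 1 & u * star u = 1]].

(* the normalized Haar measure of the unitary group of D, seen as a measure on
   M carried by that group *)
Definition is_haar (mu : probability (borelM L) R) : Prop :=
  mu unitary_group = 1%E /\
  forall v (S : set (borelM L)), unitary_group v -> measurable S ->
    mu [set u | S (v * u)] = mu S.

Definition cintegral (mu : probability (borelM L) R) (f : M -> R[i]) : R[i] :=
  (\int[mu]_(u in unitary_group) complex.Re (f u))%R%:C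
  + 'i * (\int[mu]_(u in unitary_group) complex.Im (f u))%R%:C.

(* E_(D')(xi) is the L^2-valued integral of u xi u^* du, i.e. the vector whose
   inner products with all eta are the integrals of those of u xi u^* *)
Definition E_comm (mu : probability (borelM L) R) (xi : L) : L :=
  xget 0 [set zeta | forall eta : L,
    L2dot L zeta eta =
    cintegral mu (fun u => L2dot L (ract (lact u xi) (star u)) eta)].

End Averaging.

(* Main.v *)
(* For a word w = b_0 X_(k_1) b_1 ... X_(k_m) b_m, inserting X_i on either side
   of w in the conjugate relations gives, for xi = sum_i [J_i, X_i],
     tau (xi w) = sum over the cuts w = x X_k y of
                    tau (x X_k) tau y - tau x tau (X_k y),
   while the D-valued liberation derivation of w is the sum of
   x X_k (x) y - x (x) X_k y over the same cuts.  To pass from tau (x) tau to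
   E (x) E, take matrix units e_pq of D and t_p = tau e_pp: then
   E x = sum_pq t_p^-1 tau (x e_qp) e_pq, whence
     tau (E x E y) = sum_pq t_p^-1 tau (e_qp x) tau (y e_pq).
   So tau (j a) = sum_pq t_p^-1 tau (xi e_qp a e_pq), that is
   j = sum_pq t_p^-1 e_pq xi e_qp, and since c = dim D * sum_p (t_p / n_p) e_pp
   this is dim D * (sum_pq n_p^-1 e_pq xi e_qp) c^-1, where n_p is the size of
   the block of p.  Finally E_(D') xi = sum_pq n_p^-1 e_pq xi e_qp: by
   left-invariance of the Haar measure, int <u xi u^*, eta> du is an additive
   functional of eta that is invariant under conjugation by unitaries of D,
   and the reflections 1 - 2 e_pp and the swaps of p and q suffice to show
   that such a functional only depends on sum_pq n_p^-1 e_pq eta e_qp.  *)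

Require Import Defs.
From HB Require Import structures.
From mathcomp Require Import all_boot all_order all_algebra.
From mathcomp Require Import complex.
From mathcomp Require Import all_classical all_reals all_analysis.
From mathcomp Require Import measurable_realfun.
Import Order.TTheory GRing.Theory Num.Theory.
Import numFieldNormedType.Exports.
Local Open Scope classical_set_scope.
Local Open Scope ring_scope.

Set Implicit Arguments.
Unset Strict Implicit.
Unset Printing Implicit Defensive.

(** Existence of the derivation is a separate issue: freeness supplies universal algebra
    homomorphisms only, whereas [delta] is a derivation whose values matter up to equality of
    tensors. It is therefore obtained from a homomorphism into an algebra that encodes derivations,
    and formal sums are compared only after applying a balanced map; in the final computation this
    map is [tau (E x * E y)]. The equation for the gradient is [D]-valued, while the conjugate
    relations are scalar. Since [delta] vanishes on [D], the scalar identity at all [a * d] with [d]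
    in [D] is equivalent to the [D]-valued one at [a]. In the average, u |-> u xi (star u) has no
    evident L^2-continuity on [M], which would be needed for measurability; replacing u by [E u]
    leaves only finitely many coordinates, each L^2-continuous. Finally, let P be the sum over
    matrix units that gives the average. An invariant functional takes the same value at eta and P
    eta, and P eta commutes with every unitary of [D]; so the integrand becomes the constant <xi, P
    eta>, which is <P xi, eta>. *)

Section InnerProduct.
Variables (R : realType) (H : normedModType R[i]) (dot : H -> H -> R[i]).
Hypothesis dotP : is_inner_product dot.

Lemma dotC u v : dot v u = (dot u v)^*%C.
Proof. by case: dotP. Qed.

Lemma dot_norm u : dot u u = `|u| ^+ 2.
Proof. by case: dotP. Qed.

Lemma dotDl u v w : dot (u + v) w = dot u w + dot v w.
Proof. by case: dotP => /(_ 1 u v w); rewrite scale1r mul1r. Qed.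

Lemma dot0l w : dot 0 w = 0.
Proof. by apply: (addrI (dot 0 w)); rewrite -dotDl !addr0. Qed.

Lemma dotZl a u w : dot (a *: u) w = a * dot u w.
Proof. by case: dotP => /(_ a u 0 w); rewrite !addr0 dot0l addr0. Qed.

Lemma dotBl u v w : dot (u - v) w = dot u w - dot v w.
Proof. by rewrite dotDl -scaleN1r dotZl mulN1r. Qed.

Lemma dotDr u v w : dot w (u + v) = dot w u + dot w v.
Proof. by rewrite (dotC (u + v)) dotDl rmorphD /= -!dotC. Qed.

Lemma dotZr a u w : dot w (a *: u) = a^*%C * dot w u.
Proof. by rewrite (dotC (a *: u)) dotZl rmorphM /= -dotC. Qed.

Lemma dotBr u v w : dot w (u - v) = dot w u - dot w v.
Proof. by rewrite (dotC (u - v)) dotBl rmorphB /= -!dotC. Qed.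

Lemma dot0r w : dot w 0 = 0.
Proof. by rewrite dotC dot0l; exact: rmorph0. Qed.

Lemma dot_suml I (r : seq I) (F : I -> H) w :
  dot (\sum_(i <- r) F i) w = \sum_(i <- r) dot (F i) w.
Proof. exact: (big_morph (dot^~ w) (fun u v => dotDl u v w) (dot0l w)). Qed.

Lemma dot_sumr I (r : seq I) (F : I -> H) w :
  dot w (\sum_(i <- r) F i) = \sum_(i <- r) dot w (F i).
Proof. exact: (big_morph (dot w) (fun u v => dotDr u v w) (dot0r w)). Qed.

Lemma cauchy_schwarz u v : `|dot u v| <= `|u| * `|v|.
Proof.
have [->|v0] := eqVneq v 0; first by rewrite dot0r normr0 mulr_ge0.
have nv0 : 0 < `|v| ^+ 2 by rewrite exprn_gt0 // normr_gt0.
rewrite -(@ler_pXn2r _ 2) // ?nnegrE ?mulr_ge0 // exprMn.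
(* This is the squared distance from [u] to the line spanned by [v]. *)
have : 0 <= `|u - (dot u v / `|v| ^+ 2) *: v| ^+ 2 by rewrite exprn_ge0.
rewrite -dot_norm dotBl !dotBr !dotZl !dotZr !dot_norm (dotC u v).
have -> : (dot u v / `|v| ^+ 2)^*%C = (dot u v)^*%C / `|v| ^+ 2.
  by rewrite -!dot_norm rmorphM fmorphV /= -(dotC v v).
rewrite divfK ?gt_eqF // subrr subr0 subr_ge0 mulrAC ler_pdivrMr //.
by rewrite sqr_normc mulrC.
Qed.

Lemma dot_ext u v : (forall w, dot u w = dot v w) -> u = v.
Proof.
move=> uv; apply/eqP; rewrite -subr_eq0 -normr_eq0 -sqrf_eq0 -dot_norm.
by rewrite dotBl uv subrr.
Qed.
End InnerProduct.

Lemma lipschitz_continuous (R : realType) (V W : normedModType R[i])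
    (f : V -> W) (k : R[i]) :
  0 <= k -> (forall u v, `|f u - f v| <= k * `|u - v|) -> continuous f.
Proof.
move=> k0 fk u; apply/cvgrPdist_lt => e e0.
have k1 : 0 < k + 1 by rewrite ltr_wpDl.
near=> v.
apply: (le_lt_trans (fk u v)).
apply: (@le_lt_trans _ _ ((k + 1) * `|u - v|)).
  by rewrite ler_wpM2r // lerDl.
rewrite mulrC -ltr_pdivlMr //; near: v.
by apply: cvgr_dist_lt; [exact: cvg_id | exact: divr_gt0].
Unshelve. all: by end_near. Qed.

Lemma sum_continuous (R : realType) (V W : normedModType R[i]) (I : finType)
    (F : I -> V -> W) :
  (forall i, continuous (F i)) -> continuous (fun u => \sum_i F i u).
Proof.
move=> cF u.
have h (r : seq I) : \sum_(i <- r) F i v @[v --> u] --> \sum_(i <- r) F i u.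
  elim: r => [|i r IH].
    by under eq_fun do rewrite big_nil; rewrite big_nil; exact: cvg_cst.
  under eq_fun do rewrite big_cons; rewrite big_cons.
  by apply: cvgD; [exact: cF | exact: IH].
exact: h.
Qed.

(** * Star, trace and operator bounds *)

Section TracialAlgebra.
Variables (R : realType) (M : tracialWstar R).
Implicit Types x y a : M.

Lemma starD x y : star (x + y) = star x + star y.
Proof. have := star_antilinear 1 x y.
by rewrite [X in X *: star x](_ : _ = 1) ?scale1r //; exact: conjc1. Qed.

Lemma star0 : star (0 : M) = 0.
Proof. by apply: (addrI (star 0)); rewrite -starD !addr0. Qed.

Lemma starZ (c : R[i]) x : star (c *: x) = c^*%C *: star x.
Proof. by have := star_antilinear c x 0; rewrite !addr0 star0 addr0. Qed.

Lemma starB x y : star (x - y) = star x - star y.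
Proof. by rewrite starD -scaleN1r starZ rmorphN1 scaleN1r. Qed.

Lemma star1 : star (1 : M) = 1.
Proof. by have := starM (1 : M) (star 1); rewrite mul1r starK mul1r. Qed.

Lemma star_sum I (r : seq I) (F : I -> M) :
  star (\sum_(i <- r) F i) = \sum_(i <- r) star (F i).
Proof. exact: (big_morph (@star R M) starD star0). Qed.

Lemma tauD x y : tau (x + y) = tau x + tau y.
Proof. by have := tau_linear 1 x y; rewrite scale1r mul1r. Qed.

Lemma tau0 : tau (0 : M) = 0.
Proof. by apply: (addrI (tau (0 : M))); rewrite -tauD !addr0. Qed.

Lemma tauZ (c : R[i]) x : tau (c *: x) = c * tau x.
Proof. by have := tau_linear c x 0; rewrite !addr0 tau0 addr0. Qed.

Lemma tauB x y : tau (x - y) = tau x - tau y.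
Proof. by rewrite tauD -scaleN1r tauZ mulN1r. Qed.

Lemma tau_sum I (r : seq I) (P : pred I) (F : I -> M) :
  tau (\sum_(i <- r | P i) F i) = \sum_(i <- r | P i) tau (F i).
Proof. exact: (big_morph (@tau R M) tauD tau0). Qed.

Lemma vn_piB x y u : vn_pi M (x - y) u = vn_pi M x u - vn_pi M y u.
Proof. by rewrite addrC -scaleN1r vn_pi_linear scaleN1r addrC. Qed.

Lemma vn_piZ (c : R[i]) x u : vn_pi M (c *: x) u = c *: vn_pi M x u.
Proof.
have pi0 : vn_pi M 0 u = 0 by rewrite -(subrr 0) vn_piB subrr.
by rewrite -[c *: x]addr0 vn_pi_linear pi0 addr0.
Qed.

Lemma vn_dot_star_mul x y u v :
  vn_dot M (vn_pi M (star x * y) u) v = vn_dot M (vn_pi M y u) (vn_pi M x v).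
Proof. by rewrite vn_piM vn_pi_star starK. Qed.

Lemma positive_star_mul x : positive (star x * x).
Proof. by move=> u; rewrite vn_dot_star_mul (dot_norm (vn_dotP M)) exprn_ge0. Qed.

(** The operator bound of [a], applied to the vectors [x u], says that the difference of the two
    arguments of [tau] is positive. *)
Lemma tau_star_mul_bound a :
  exists2 k : R[i], 0 <= k & forall x,
    tau (star x * (star a * a) * x) <= k ^+ 2 * tau (star x * x).
Proof.
have [_ [k0 hk0]] := vn_pi_bounded a.
exists `|k0| => [//|x].
rewrite -subr_ge0 -tauZ -tauB; apply: tau_positive => u.
rewrite vn_piB vn_piZ (dotBl (vn_dotP M)) (dotZl (vn_dotP M)) subr_ge0.
have -> : star x * (star a * a) * x = star (a * x) * (a * x).
  by rewrite starM !mulrA.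
rewrite !vn_dot_star_mul !(dot_norm (vn_dotP M)) -exprMn.
rewrite ler_pXn2r // ?nnegrE ?mulr_ge0 //.
rewrite vn_piM; apply: (le_trans (hk0 _)).
(* The bound [k0] is just a complex number; what is known to be nonnegative is its product with a
   norm, because it dominates a norm. Hence the choice of its modulus as constant. *)
have /ger0_norm <- : 0 <= k0 * `|vn_pi M x u| by apply: le_trans (hk0 _).
by rewrite normrM normr_id.
Qed.

End TracialAlgebra.

(** * Extension by continuity to L^2 *)

Section Extension.
Variables (R : realType) (M : tracialWstar R) (L : L2space M).
Implicit Types (x y a : M) (xi eta : L).
Local Notation emb := (L2emb L).
Local Notation dot := (L2dot L).

Lemma embD x y : emb (x + y) = emb x + emb y.
Proof. by have := L2emb_linear L 1 x y; rewrite !scale1r. Qed.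

Lemma emb0 : emb 0 = 0.
Proof. by apply: (addrI (emb 0)); rewrite -embD !addr0. Qed.

Lemma embZ (c : R[i]) x : emb (c *: x) = c *: emb x.
Proof. by have := L2emb_linear L c x 0; rewrite !addr0 emb0 addr0. Qed.

Lemma embB x y : emb (x - y) = emb x - emb y.
Proof. by rewrite embD -scaleN1r embZ scaleN1r. Qed.

Lemma emb_sum I (r : seq I) (F : I -> M) :
  emb (\sum_(i <- r) F i) = \sum_(i <- r) emb (F i).
Proof. exact: (big_morph (L2emb L) embD emb0). Qed.

Lemma norm_emb x : `|emb x| ^+ 2 = tau (x * star x).
Proof. by rewrite -(dot_norm (L2dotP L)) L2emb_dot. Qed.

Lemma tau_dot x : tau x = dot (emb x) (emb 1).
Proof. by rewrite L2emb_dot star1 mulr1. Qed.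

(** With [tau (x * star x)] as squared norm, right multiplication is bounded directly, while left
    multiplication first needs the trace to move [a] next to its adjoint. *)
Lemma lmul_bound a :
  exists2 k : R[i], 0 <= k & forall x, `|emb (a * x)| <= k * `|emb x|.
Proof.
have [k k0 hk] := tau_star_mul_bound a; exists k => // x.
rewrite -(@ler_pXn2r _ 2) // ?nnegrE ?mulr_ge0 // exprMn !norm_emb.
have := hk x; rewrite (tau_trace x) starM; congr (_ <= _).
by rewrite [RHS]tau_trace !mulrA.
Qed.

Lemma rmul_bound a :
  exists2 k : R[i], 0 <= k & forall x, `|emb (x * a)| <= k * `|emb x|.
Proof.
have [k k0 hk] := tau_star_mul_bound (star a); exists k => // x.
rewrite -(@ler_pXn2r _ 2) // ?nnegrE ?mulr_ge0 // exprMn !norm_emb.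
by have := hk (star x); rewrite !starK starM !mulrA.
Qed.

Lemma emb_near xi (e : R[i]) : 0 < e -> exists x, `|xi - emb x| < e.
Proof.
move=> e0; have : closure (range emb) xi by rewrite L2emb_dense.
move=> /(_ (ball xi e)) /(_ (nbhsx_ballx xi e e0)) [_ [[x _ <-]]].
by rewrite -ball_normE; exists x.
Qed.

Definition emb_nbhs xi : set_system M :=
  filter_from (nbhs xi) (fun O => emb @^-1` O).

Lemma emb_nbhs_filter xi : ProperFilter (emb_nbhs xi).
Proof.
apply: filter_from_proper.
  apply: filter_from_filter; first by exists setT; exact: filterT.
  by move=> A B nA nB; exists (A `&` B) => //; exact: filterI.
move=> A /nbhs_ballP [e /= e0 sA].
have [x hx] := emb_near xi e0; exists x; apply: sA.
by rewrite -ball_normE.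
Qed.
#[local] Existing Instance emb_nbhs_filter.

Lemma emb_cvg xi : emb x @[x --> emb_nbhs xi] --> xi.
Proof. by move=> A nA; exists A. Qed.

(** When a continuous extension is already at hand, as for [tau2] and [E2], the limit is identified
    without any completeness argument. *)
Lemma ext_continuous (V : normedModType R[i]) (f : M -> V) (F : L -> V) xi :
  continuous F -> (forall x, F (emb x) = f x) -> ext f xi = F xi.
Proof.
move=> cF Ff; apply: cvg_lim; first exact: norm_hausdorff.
have -> : f = F \o emb by apply/funext => x; rewrite /= Ff.
exact: (cvg_comp _ _ (emb_cvg (xi := xi)) (cF xi)).
Qed.

(** Carries identities from [M], where both actions are multiplication, to all of L^2. *)
Lemma dense_eq (V : normedModType R[i]) (F G : L -> V) :
  continuous F -> continuous G -> (forall x, F (emb x) = G (emb x)) ->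
  F =1 G.
Proof.
move=> cF cG FG xi.
rewrite -(@ext_continuous _ (F \o emb) F) //.
by apply: ext_continuous => // x; rewrite -FG.
Qed.

Section BoundedExtension.
Variables (V : completeNormedModType R[i]) (f : M -> V) (k : R[i]).
Hypothesis k0 : 0 <= k.
Hypothesis fk : forall x y, `|f x - f y| <= k * `|emb x - emb y|.

Lemma ext_cvg xi : f x @[x --> emb_nbhs xi] --> ext f xi.
Proof.
suff : cvg (f x @[x --> emb_nbhs xi]) by [].
apply: cauchy_cvg; apply: cauchy_exP => e e0.
have k1 : 0 < k + 1 by rewrite ltr_wpDl.
(* Two points within [d] of [xi] are less than [e / (k + 1)] apart, so their images are less than
   [e] apart; [k + 1] replaces [k], which may be zero. *)
pose d := e / (k + 1) / 2.
have d0 : 0 < d by rewrite !divr_gt0.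
have [y hy] := emb_near xi d0.
exists (f y); exists (ball xi d); first exact: nbhsx_ballx.
move=> x /=; rewrite -ball_normE /= => hx; rewrite -ball_normE /=.
apply: (le_lt_trans (fk _ _)).
have hxy : `|emb y - emb x| < e / (k + 1).
  rewrite -(subrKA xi); apply: (le_lt_trans (ler_normD _ _)).
  by rewrite distrC [ltRHS]splitr ltrD.
rewrite ltr_pdivlMr // mulrC in hxy; apply: le_lt_trans hxy.
by rewrite ler_wpM2r // lerDl.
Qed.

(** The estimate between a point of L^2 and a point of [M], from which both the agreement of [ext f]
    with [f] and its Lipschitz bound follow. *)
Lemma ext_approx xi y : `|ext f xi - f y| <= k * `|xi - emb y|.
Proof.
apply/ler_addgt0Pr => e e0.
have k1 : 0 < k + 1 by rewrite ltr_wpDl.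
have e1 : 0 < e / 2 / (k + 1) by rewrite !divr_gt0.
have e2 : 0 < e / 2 by rewrite divr_gt0.
have /cvgrPdist_lt /(_ _ e2) nf := ext_cvg (xi := xi).
have /cvgrPdist_lt /(_ _ e1) ne := emb_cvg (xi := xi).
have [x [/= hf he]] := filter_ex (filterI nf ne).
rewrite -(subrKA (f x)); apply: (le_trans (ler_normD _ _)).
rewrite addrC [e]splitr addrA lerD ?(ltW hf) //.
apply: (le_trans (fk _ _)); rewrite -(subrKA xi).
apply: (@le_trans _ _ (k * (`|emb x - xi| + `|xi - emb y|))).
  by rewrite ler_wpM2l // ler_normD.
rewrite mulrDr [leRHS]addrC lerD // distrC.
rewrite ltr_pdivlMr // mulrC in he; apply: le_trans (ltW he).
by rewrite ler_wpM2r // lerDl.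
Qed.

Lemma ext_emb y : ext f (emb y) = f y.
Proof.
apply/eqP; rewrite -subr_eq0 -normr_le0 (le_trans (ext_approx _ _)) //.
by rewrite subrr normr0 mulr0.
Qed.

Lemma ext_lipschitz xi eta : `|ext f xi - ext f eta| <= k * `|xi - eta|.
Proof.
apply/ler_addgt0Pr => e e0.
have k1 : 0 < k + 1 by rewrite ltr_wpDl.
have e1 : 0 < e / 2 / (k + 1) by rewrite !divr_gt0.
have [x hx] := emb_near eta e1.
have hkx : k * `|eta - emb x| <= e / 2.
  rewrite ltr_pdivlMr // mulrC in hx; apply: le_trans (ltW hx).
  by rewrite ler_wpM2r // lerDl.
rewrite -(subrKA (f x)); apply: (le_trans (ler_normD _ _)).
rewrite [X in _ + X]distrC.
apply: (le_trans (lerD (ext_approx _ _) (ext_approx _ _))).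
rewrite [e]splitr addrA lerD //.
rewrite -(subrKA eta).
apply: (@le_trans _ _ (k * (`|xi - eta| + `|eta - emb x|))).
  by rewrite ler_wpM2l // ler_normD.
by rewrite mulrDr lerD.
Qed.

End BoundedExtension.

Lemma lact_lipschitz a :
  exists2 k : R[i], 0 <= k & forall xi eta,
    `|lact a xi - lact a eta| <= k * `|xi - eta|.
Proof.
have [k k0 hk] := lmul_bound a; exists k => //.
by apply: ext_lipschitz => // x y; rewrite -embB -mulrBr -embB.
Qed.

Lemma lact_emb a x : lact a (emb x) = emb (a * x).
Proof.
have [k k0 hk] := lmul_bound a.
by apply: (ext_emb k0) => y z; rewrite -embB -mulrBr -embB.
Qed.

Lemma ract_lipschitz a :
  exists2 k : R[i], 0 <= k & forall xi eta,
    `|ract xi a - ract eta a| <= k * `|xi - eta|.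
Proof.
have [k k0 hk] := rmul_bound a; exists k => //.
by apply: ext_lipschitz => // x y; rewrite -embB -mulrBl -embB.
Qed.

Lemma ract_emb a x : ract (emb x) a = emb (x * a).
Proof.
have [k k0 hk] := rmul_bound a.
by apply: (ext_emb k0) => y z; rewrite -embB -mulrBl -embB.
Qed.

Lemma lact_continuous a : continuous (@lact R M L a).
Proof. by have [k k0] := lact_lipschitz a; exact: lipschitz_continuous. Qed.

Lemma ract_continuous a : continuous ((@ract R M L)^~ a).
Proof. by have [k k0] := ract_lipschitz a; exact: lipschitz_continuous. Qed.

Lemma dotl_continuous eta : continuous (dot^~ eta : L -> R[i]^o).
Proof.
apply: (@lipschitz_continuous _ _ _ _ `|eta|) => // u v.
by rewrite -(dotBl (L2dotP L)) mulrC; exact: (cauchy_schwarz (L2dotP L)).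
Qed.

Lemma dotr_continuous eta : continuous (dot eta : L -> R[i]^o).
Proof.
apply: (@lipschitz_continuous _ _ _ _ `|eta|) => // u v.
by rewrite -(dotBr (L2dotP L)); exact: (cauchy_schwarz (L2dotP L)).
Qed.

Lemma tau2_dot xi : tau2 xi = dot xi (emb 1).
Proof.
apply: (@ext_continuous R[i]^o _ (dot^~ (emb 1))).
  exact: dotl_continuous.
by move=> x; rewrite -tau_dot.
Qed.

Lemma tau2_emb x : tau2 (emb x) = tau x.
Proof. by rewrite tau2_dot -tau_dot. Qed.

Lemma lactM a b xi : lact (a * b) xi = lact a (lact b xi).
Proof.
apply: (@dense_eq _ (lact (a * b)) (fun u => lact a (lact b u))).
- exact: lact_continuous.
- by move=> u; apply: continuous_comp; exact: lact_continuous.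
- by move=> x; rewrite !lact_emb mulrA.
Qed.

Lemma ractM a b xi : ract xi (a * b) = ract (ract xi a) b.
Proof.
apply: (@dense_eq _ (fun u => ract u (a * b)) (fun u => ract (ract u a) b)).
- exact: ract_continuous.
- by move=> u; apply: (continuous_comp (@ract_continuous a u)); exact: ract_continuous.
- by move=> x; rewrite !ract_emb mulrA.
Qed.

Lemma lact_ract a b xi : lact a (ract xi b) = ract (lact a xi) b.
Proof.
apply: (@dense_eq _ (fun u => lact a (ract u b)) (fun u => ract (lact a u) b)).
- by move=> u; apply: (continuous_comp (@ract_continuous b u)); exact: lact_continuous.
- by move=> u; apply: (continuous_comp (@lact_continuous a u)); exact: ract_continuous.
- by move=> x; rewrite !(ract_emb, lact_emb) mulrA.
Qed.

Lemma lact1 xi : lact 1 xi = xi.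
Proof.
apply: (@dense_eq _ (lact 1) id).
- exact: lact_continuous.
- by move=> u; exact: cvg_id.
- by move=> x; rewrite lact_emb mul1r.
Qed.

Lemma ract1 xi : ract xi 1 = xi.
Proof.
apply: (@dense_eq _ (fun u => ract u 1) id).
- exact: ract_continuous.
- by move=> u; exact: cvg_id.
- by move=> x; rewrite ract_emb mulr1.
Qed.

Lemma lact_linearl (c : R[i]) a b xi :
  lact (c *: a + b) xi = c *: lact a xi + lact b xi.
Proof.
apply: (@dense_eq _ (lact (c *: a + b)) (fun u => c *: lact a u + lact b u)).
- exact: lact_continuous.
- move=> u; apply: cvgD; last exact: lact_continuous.
  by apply: cvgZr; exact: lact_continuous.
- by move=> x; rewrite !lact_emb mulrDl -scalerAl L2emb_linear.
Qed.

Lemma ract_linearr (c : R[i]) a b xi :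
  ract xi (c *: a + b) = c *: ract xi a + ract xi b.
Proof.
apply: (@dense_eq _ (fun u => ract u (c *: a + b)) (fun u => c *: ract u a + ract u b)).
- exact: ract_continuous.
- move=> u; apply: cvgD; last exact: ract_continuous.
  by apply: cvgZr; exact: ract_continuous.
- by move=> x; rewrite !ract_emb mulrDr -scalerAr L2emb_linear.
Qed.

Lemma dotl_comp_continuous (F : L -> L) eta :
  continuous F -> continuous ((fun u => dot (F u) eta) : L -> R[i]^o).
Proof.
by move=> cF u; exact: (@continuous_comp _ _ R[i]^o F _ u (cF u) (@dotl_continuous _ _)).
Qed.

Lemma dotr_comp_continuous (F : L -> L) xi :
  continuous F -> continuous ((fun u => dot xi (F u)) : L -> R[i]^o).
Proof.
by move=> cF u; exact: (@continuous_comp _ _ R[i]^o F _ u (cF u) (@dotr_continuous _ _)).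
Qed.

Lemma dot_lact a xi eta : dot (lact a xi) eta = dot xi (lact (star a) eta).
Proof.
apply: (@dense_eq R[i]^o (fun u => dot (lact a u) eta) (dot^~ (lact (star a) eta))).
- by apply: dotl_comp_continuous; exact: lact_continuous.
- exact: dotl_continuous.
- move=> x; apply: (@dense_eq R[i]^o (dot (lact a (emb x)))
    (fun u => dot (emb x) (lact (star a) u))).
  + exact: dotr_continuous.
  + by apply: dotr_comp_continuous; exact: lact_continuous.
  + by move=> y; rewrite !lact_emb !L2emb_dot starM starK mulrA [RHS]tau_trace mulrA.
Qed.

Lemma dot_ract a xi eta : dot (ract xi a) eta = dot xi (ract eta (star a)).
Proof.
apply: (@dense_eq R[i]^o (fun u => dot (ract u a) eta) (dot^~ (ract eta (star a)))).
- by apply: (@dotl_comp_continuous ((@ract R M L)^~ a)); exact: ract_continuous.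
- exact: dotl_continuous.
- move=> x; apply: (@dense_eq R[i]^o (dot (ract (emb x) a))
    (fun u => dot (emb x) (ract u (star a)))).
  + exact: dotr_continuous.
  + by apply: (@dotr_comp_continuous ((@ract R M L)^~ (star a))); exact: ract_continuous.
  + by move=> y; rewrite !ract_emb !L2emb_dot starM starK mulrA.
Qed.

End Extension.

Section Bimodule.
Variables (R : realType) (M : tracialWstar R) (L : L2space M).
Implicit Types (x y a b : M) (xi eta : L).
Local Notation dot := (L2dot L).

Lemma lactZl (c : R[i]) a xi : lact (c *: a) xi = c *: lact a xi.
Proof.
(* Taking both elements equal to [a] yields homogeneity before the action of [0] is known to
   vanish. *)
have := lact_linearl (c - 1) a a xi.
rewrite -[X in (_ *: _ + X)]scale1r -scalerDl subrK => ->.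
by rewrite -[X in _ + X]scale1r -scalerDl subrK.
Qed.

Lemma lactDl a b xi : lact (a + b) xi = lact a xi + lact b xi.
Proof. by have := lact_linearl 1 a b xi; rewrite !scale1r. Qed.

Lemma lact0l xi : lact 0 xi = 0.
Proof. by rewrite -(scale0r (0 : M)) lactZl scale0r. Qed.

Lemma lact_suml I (r : seq I) (F : I -> M) xi :
  lact (\sum_(i <- r) F i) xi = \sum_(i <- r) lact (F i) xi.
Proof. exact: (big_morph (fun a => lact a xi) (fun a b => lactDl a b xi) (lact0l xi)). Qed.

Lemma ractDr a b xi : ract xi (a + b) = ract xi a + ract xi b.
Proof. by have := ract_linearr 1 a b xi; rewrite !scale1r. Qed.

Lemma ractZr (c : R[i]) a xi : ract xi (c *: a) = c *: ract xi a.
Proof.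
have := ract_linearr (c - 1) a a xi.
rewrite -[X in (_ *: _ + X)]scale1r -scalerDl subrK => ->.
by rewrite -[X in _ + X]scale1r -scalerDl subrK.
Qed.

Lemma ract0r xi : ract xi 0 = 0.
Proof. by rewrite -(scale0r (0 : M)) ractZr scale0r. Qed.

Lemma ract_sumr I (r : seq I) (F : I -> M) xi :
  ract xi (\sum_(i <- r) F i) = \sum_(i <- r) ract xi (F i).
Proof. exact: (big_morph (ract xi) (fun a b => ractDr a b xi) (ract0r xi)). Qed.

(** An operator possessing an adjoint is linear, so no further density argument is needed. *)
Lemma lactDr a xi eta : lact a (xi + eta) = lact a xi + lact a eta.
Proof.
apply: (dot_ext (L2dotP L)) => z.
by rewrite (dotDl (L2dotP L)) !dot_lact (dotDl (L2dotP L)).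
Qed.

Lemma lactZr a (c : R[i]) xi : lact a (c *: xi) = c *: lact a xi.
Proof.
apply: (dot_ext (L2dotP L)) => z.
by rewrite (dotZl (L2dotP L)) !dot_lact (dotZl (L2dotP L)).
Qed.

Lemma ractDl a xi eta : ract (xi + eta) a = ract xi a + ract eta a.
Proof.
apply: (dot_ext (L2dotP L)) => z.
by rewrite (dotDl (L2dotP L)) !dot_ract (dotDl (L2dotP L)).
Qed.

Lemma ractZl a (c : R[i]) xi : ract (c *: xi) a = c *: ract xi a.
Proof.
apply: (dot_ext (L2dotP L)) => z.
by rewrite (dotZl (L2dotP L)) !dot_ract (dotZl (L2dotP L)).
Qed.

Lemma lactNl a xi : lact (- a) xi = - lact a xi.
Proof. by rewrite -scaleN1r lactZl scaleN1r. Qed.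

Lemma ractNl a xi : ract (- xi) a = - ract xi a.
Proof. by rewrite -scaleN1r ractZl scaleN1r. Qed.

Lemma ract0l a : ract (0 : L) a = 0.
Proof. by rewrite -[X in ract X a](scale0r (0 : L)) ractZl scale0r. Qed.

Lemma lact0r a : lact a (0 : L) = 0.
Proof. by rewrite -[X in lact a X](scale0r (0 : L)) lactZr scale0r. Qed.

Lemma ract_suml I (r : seq I) (F : I -> L) a :
  ract (\sum_(i <- r) F i) a = \sum_(i <- r) ract (F i) a.
Proof. exact: (big_morph (fun u => ract u a) (fun u v => ractDl a u v) (ract0l a)). Qed.

Lemma lact_sumr I (r : seq I) (F : I -> L) a :
  lact a (\sum_(i <- r) F i) = \sum_(i <- r) lact a (F i).
Proof. exact: (big_morph (lact a) (lactDr a) (lact0r a)). Qed.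

Lemma tau2D xi eta : tau2 (xi + eta) = tau2 xi + tau2 eta.
Proof. by rewrite !tau2_dot (dotDl (L2dotP L)). Qed.

Lemma tau2Z (c : R[i]) xi : tau2 (c *: xi) = c * tau2 xi.
Proof. by rewrite !tau2_dot (dotZl (L2dotP L)). Qed.

Lemma tau2_sum I (r : seq I) (F : I -> L) :
  tau2 (\sum_(i <- r) F i) = \sum_(i <- r) tau2 (F i).
Proof.
rewrite tau2_dot (dot_suml (L2dotP L)).
by apply: eq_bigr => i _; rewrite tau2_dot.
Qed.

Lemma tau2_trace a xi : tau2 (lact a xi) = tau2 (ract xi a).
Proof.
by rewrite !tau2_dot dot_lact dot_ract lact_emb ract_emb mulr1 mul1r.
Qed.

End Bimodule.

(** * Matrix units of a finite-dimensional algebra *)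

(** Units are indexed by all pairs, and those joining different blocks are forced to be zero; this
    allows unrestricted double sums. *)
Record matrix_units (R : realType) (M : tracialWstar R) (D : set M)
    (K T : finType) (blk : T -> K) (e : T -> T -> M) : Prop := MatrixUnits {
  mu_mem : forall x y, D (e x y);
  mu_mul : forall x y z w,
    e x y * e z w = ((y == z) && (blk x == blk y))%:R *: e x w;
  mu_star : forall x y, star (e x y) = e y x;
  mu_one : \sum_x e x x = 1;
  mu_span : forall d, D d -> exists c : T -> T -> R[i],
    d = \sum_x \sum_y c x y *: e x y;
  mu_neq0 : forall x, e x x != 0
}.

Section MatrixUnits.
Variables (R : realType) (M : tracialWstar R) (D : set M).
Variables (K T : finType) (blk : T -> K) (e : T -> T -> M).
Hypothesis eP : matrix_units D blk e.

Definition wt x := tau (e x x).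

Lemma mu_offblock x y : blk x != blk y -> e x y = 0.
Proof.
move=> xy; rewrite -[e x y]mulr1 -(mu_one eP) big_distrr /= big1 // => z _.
by rewrite (mu_mul eP) (negbTE xy) andbF scale0r.
Qed.

Lemma mu_mul_mid x y w : blk x = blk y -> e x y * e y w = e x w.
Proof. by move=> xy; rewrite (mu_mul eP) eqxx xy eqxx scale1r. Qed.

Lemma mu_mul_neq x y z w : y != z -> e x y * e z w = 0.
Proof. by move=> yz; rewrite (mu_mul eP) (negbTE yz) scale0r. Qed.

Lemma tau_mu x y : tau (e x y) = (x == y)%:R * wt x.
Proof.
have [->|xy] := eqVneq x y; first by rewrite mul1r.
rewrite mul0r -(mu_mul_mid (x := x) (y := x)) // tau_trace (mu_mul eP).
by rewrite eq_sym (negbTE xy) scale0r tau0.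
Qed.

Lemma wt_neq0 x : wt x != 0.
Proof.
apply/eqP => w0; have /eqP := mu_neq0 eP x; apply.
have h : star (e x x) * e x x = e x x by rewrite (mu_star eP) mu_mul_mid.
by rewrite -h; apply: tau_faithful; [exact: positive_star_mul | rewrite h].
Qed.

Lemma wt_block x y : blk x = blk y -> wt x = wt y.
Proof.
by move=> xy; rewrite /wt -(mu_mul_mid (y := y) x xy) tau_trace mu_mul_mid.
Qed.

Variable E : M -> M.
Hypothesis hD1 : D 1.
Hypothesis hE : cond_exp D E.
Hypothesis htauE : forall x, tau (E x) = tau x.

Lemma cond_expMr a d : D d -> E (a * d) = E a * d.
Proof. by case: hE => _ _ _ /(_ 1 a d hD1); rewrite !mul1r. Qed.

Lemma cond_expMl a d : D d -> E (d * a) = d * E a.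
Proof. by case: hE => _ _ _ /(_ d a 1) h Dd; have := h Dd hD1; rewrite !mulr1. Qed.

Lemma cond_exp_id a : D a -> E a = a.
Proof. by move=> Da; have := cond_expMl 1 Da; case: hE => _ -> _ _; rewrite !mulr1. Qed.

Lemma cond_exp_mu a :
  E a = \sum_x \sum_y (tau (a * e y x) / wt x) *: e x y.
Proof.
have [DE _ _ _] := hE; have [c hc] := mu_span eP (DE a).
rewrite {1}hc; apply: eq_bigr => x _; apply: eq_bigr => y _.
have [xy|/mu_offblock ->] := eqVneq (blk x) (blk y); last by rewrite !scaler0.
(* Pairing with [e y x] isolates the coefficient of [e x y], and [tau] does not see [E]. *)
congr (_ *: _); rewrite -htauE (cond_expMr _ (mu_mem eP y x)) hc.
rewrite big_distrl /= tau_sum (bigD1 x) //= [X in _ + X]big1 ?addr0 => [|z zx].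
  rewrite big_distrl /= tau_sum (bigD1 y) //= [X in _ + X]big1 ?addr0 => [|w wy].
    by rewrite -scalerAl tauZ mu_mul_mid // mulfK // wt_neq0.
  by rewrite -scalerAl (mu_mul eP) (negbTE wy) scale0r scaler0 tau0.
rewrite big_distrl /= tau_sum big1 // => w _.
by rewrite -scalerAl (mu_mul eP) scalerA tauZ tau_mu (negbTE zx) mul0r mulr0.
Qed.

Lemma tau_cond_exp_mul a b :
  tau (E a * E b) =
  \sum_x \sum_y (wt x)^-1 * (tau (e y x * a) * tau (b * e x y)).
Proof.
have [DE _ _ _] := hE.
(* Only the expectation of [b] has to be expanded; the outer one is absorbed by the trace. *)
rewrite -(cond_expMr _ (DE b)) htauE (cond_exp_mu b) big_distrr tau_sum /=.
rewrite exchange_big /=; apply: eq_bigr => x _.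
rewrite big_distrr tau_sum /=; apply: eq_bigr => y _.
have [xy|xy] := eqVneq (blk x) (blk y); last first.
  by rewrite (mu_offblock xy) scaler0 mulr0 mul0r tau0 mul0r mulr0.
rewrite -scalerAr tauZ (wt_block xy) [tau (e x y * a)]tau_trace.
by rewrite mulrAC mulrC [X in _ = _ * X]mulrC.
Qed.
End MatrixUnits.

Section CondExpectationL2.
Variables (R : realType) (M : tracialWstar R) (L : L2space M) (D : set M).
Variables (K T : finType) (blk : T -> K) (e : T -> T -> M).
Hypothesis eP : matrix_units D blk e.
Variable E : M -> M.
Hypothesis hD1 : D 1.
Hypothesis hE : cond_exp D E.
Hypothesis htauE : forall x, tau (E x) = tau x.

(** A finite sum of continuous functionals times fixed vectors, so that extending [E] to L^2
    requires no contractivity estimate. *)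
Definition E2_expansion (u : L) : L :=
  \sum_x \sum_y (tau2 (ract u (e y x)) / wt e x) *: L2emb L (e x y).

Lemma E2_expansion_continuous : continuous E2_expansion.
Proof.
apply: sum_continuous => x; apply: sum_continuous => y u.
apply: cvgZl; apply: (@cvgM R[i]); last exact: cvg_cst.
under eq_fun do rewrite tau2_dot.
rewrite tau2_dot.
apply: (@dotl_comp_continuous _ _ _ ((@ract R M L)^~ (e y x))).
exact: ract_continuous.
Qed.

Lemma E2E xi : E2 E xi = E2_expansion xi.
Proof.
apply: ext_continuous => [|a]; first exact: E2_expansion_continuous.
rewrite (cond_exp_mu eP hD1 hE htauE a) emb_sum; apply: eq_bigr => x _.
rewrite emb_sum; apply: eq_bigr => y _.
by rewrite ract_emb tau2_emb embZ.
Qed.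

Lemma E2_continuous : continuous (E2 E : L -> L).
Proof.
have -> : E2 E = E2_expansion by apply/funext => xi; exact: E2E.
exact: E2_expansion_continuous.
Qed.

(** Lets the [D]-valued equation of the gradient be checked by scalar traces against [D]. *)
Lemma E2_determined xi a : D a ->
  (forall d, D d -> tau2 (ract xi d) = tau (a * d)) ->
  E2 E xi = L2emb L a.
Proof.
move=> Da h; rewrite E2E -[in RHS](cond_exp_id hD1 hE Da).
rewrite (cond_exp_mu eP hD1 hE htauE a) emb_sum; apply: eq_bigr => x _.
rewrite emb_sum; apply: eq_bigr => y _.
by rewrite h ?embZ //; exact: (mu_mem eP).
Qed.

Lemma E2_emb a : E2 E (L2emb L a) = L2emb L (E a).
Proof.
have [DE _ _ _] := hE; apply: E2_determined => [//|d Dd].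
by rewrite ract_emb tau2_emb -(cond_expMr hD1 hE _ Dd) htauE.
Qed.

End CondExpectationL2.

(** * Matrix units of a block decomposition *)

Section BlockUnits.
Variables (R : realType) (M : tracialWstar R) (D : set M).
Variables (k : nat) (m : 'I_k -> nat) (phi : (forall j, 'M[R[i]]_(m j)) -> M).
Hypothesis hphi : is_block_iso D phi.

Definition block_index := {j : 'I_k & 'I_(m j)}.

Definition bidx (j : 'I_k) (a : 'I_(m j)) : block_index := existT _ j a.

Definition block_delta (x y : block_index) : forall j, 'M[R[i]]_(m j) :=
  fun j => \matrix_(a, b) ((bidx a == x) && (bidx b == y))%:R.

Definition block_unit (x y : block_index) : M := phi (block_delta x y).

Lemma phiD U V : phi (fun j => U j + V j) = phi U + phi V.
Proof.
case: hphi => _ [_ h] _ _ _; rewrite -[phi U]scale1r -h; congr phi.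
by apply: functional_extensionality_dep => j; rewrite scale1r.
Qed.

Lemma phi0 : phi (fun=> 0) = 0.
Proof.
apply: (addrI (phi (fun=> 0))); rewrite -phiD addr0; congr phi.
by apply: functional_extensionality_dep => j; rewrite addr0.
Qed.

Lemma phiZ (c : R[i]) U : phi (fun j => c *: U j) = c *: phi U.
Proof.
case: hphi => _ [_ h] _ _ _; rewrite -[RHS]addr0 -phi0 -h; congr phi.
by apply: functional_extensionality_dep => j; rewrite addr0.
Qed.

Lemma phi_sum (I : finType) (F : I -> forall j, 'M[R[i]]_(m j)) :
  phi (fun j => \sum_i F i j) = \sum_i phi (F i).
Proof.
suff h (r : seq I) : phi (fun j => \sum_(i <- r) F i j) = \sum_(i <- r) phi (F i).
  exact: h.
elim: r => [|i r IH].
  rewrite big_nil -phi0; congr phi.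
  by apply: functional_extensionality_dep => j; rewrite big_nil.
rewrite big_cons -IH -phiD; congr phi.
by apply: functional_extensionality_dep => j; rewrite big_cons.
Qed.

Lemma bidx_eq j (a b : 'I_(m j)) : (bidx a == bidx b) = (a == b).
Proof. by rewrite /bidx -tag_eqE /tag_eq eqxx /= tagged_asE. Qed.

(** The point [y] may belong to another block than the one summed over, whence the indicator that
    survives. *)
Lemma sum_bidx (V : zmodType) j (y : block_index) (F : block_index -> V) :
  \sum_(b < m j) F (bidx b) *+ (bidx b == y) = F y *+ (tag y == j).
Proof.
have [<-{j}|yj] := eqVneq (tag y) j.
  rewrite (bigD1 (tagged y)) //= big1 => [|b bny].
    by rewrite addr0; case: y => j c /=; rewrite eqxx.
  by case: y b bny => j c /= b bny; rewrite bidx_eq (negbTE bny).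
rewrite big1 // => b _; case: eqVneq => // yb.
by rewrite -yb eqxx in yj.
Qed.

Lemma block_unit_mul x y z w :
  block_unit x y * block_unit z w =
  ((y == z) && (tag x == tag y))%:R *: block_unit x w.
Proof.
case: (hphi) => _ _ [hM _] _ _.
rewrite -hM -phiZ; congr phi; apply: functional_extensionality_dep => j.
apply/matrixP => a c; rewrite !mxE.
under eq_bigr => b _ do rewrite !mxE.
(* [F] collects every test except the one against [y], which the Kronecker sum consumes. *)
pose F (b : block_index) : R[i] := ((bidx a == x) && (b == z) && (bidx c == w))%:R.
transitivity (\sum_(b < m j) F (bidx b) *+ (bidx b == y)).
  apply: eq_bigr => b _; rewrite /F.
  by case: (bidx a == x); case: (bidx b == y); case: (bidx b == z); case: (bidx c == w);
    rewrite /= ?(mulr0, mul0r, mulr1, mulr0n).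
rewrite sum_bidx /F.
have [<-|_] := eqVneq (bidx a) x; last by rewrite /= mulr0 mul0rn.
rewrite /= [j == _]eq_sym; case: (y == z); case: (bidx c == w); case: (tag y == j);
    by rewrite /= ?(mulr0, mul0r, mulr1, mulr0n).
Qed.

Lemma block_units : matrix_units D (@tag _ (fun j => 'I_(m j))) block_unit.
Proof.
case: (hphi) => _ [h1 _] [_ hs] hi hD; split.
- by move=> x y; rewrite -hD; exists (block_delta x y).
- exact: block_unit_mul.
- move=> x y; rewrite /block_unit -hs; congr phi.
  apply: functional_extensionality_dep => j; apply/matrixP => a b.
  by rewrite !mxE andbC; apply: rmorph_nat.
- rewrite -h1 -phi_sum; congr phi; apply: functional_extensionality_dep => j.
  apply/matrixP => a b; rewrite !mxE summxE (bigD1 (bidx a)) //= [X in _ + X]big1 => [|x xa].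
    by rewrite !mxE eqxx addr0 bidx_eq eq_sym.
  by rewrite mxE [bidx a == x]eq_sym (negbTE xa).
- move=> d; rewrite -hD => -[U _ <-].
  (* This is the entry of [U] at [(x, y)], and zero when the blocks differ; writing it as a sum over
     [b] avoids transporting [y] into the block of [x]. *)
  pose c (x y : block_index) : R[i] :=
    \sum_(b < m (tag x)) U (tag x) (tagged x) b *+ (bidx b == y).
  exists c; rewrite /block_unit.
  under eq_bigr => x _ do under eq_bigr => y _ do rewrite -phiZ.
  under eq_bigr => x _ do rewrite -phi_sum.
  rewrite -phi_sum; congr phi; apply: functional_extensionality_dep => j.
  apply/matrixP => a b; rewrite summxE (bigD1 (bidx a)) //= [X in _ + X]big1 => [|x xa].
    rewrite addr0 summxE (bigD1 (bidx b)) //= [X in _ + X]big1 => [|y yb].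
      rewrite !mxE !eqxx mulr1 !addr0 /c /= (bigD1 b) //= eqxx big1 ?addr0 //.
      by move=> b' b'b; rewrite bidx_eq (negbTE b'b).
    by rewrite !mxE [bidx b == y]eq_sym (negbTE yb) andbF mulr0.
  rewrite summxE big1 // => y _.
  by rewrite !mxE [bidx a == x]eq_sym (negbTE xa) mulr0.
- move=> x; rewrite -phi0; apply/eqP => /hi.
  move=> /(congr1 (fun U => U (tag x))) /matrixP /(_ (tagged x) (tagged x)).
  rewrite !mxE; case: x => j a /=; rewrite eqxx => /eqP.
  by rewrite oner_eq0.
Qed.

Lemma block_projE j : block_proj phi j = \sum_(x | tag x == j) block_unit x x.
Proof.
rewrite big_mkcond /=.
transitivity (\sum_x phi (fun l => (tag x == j)%:R *: block_delta x x l)); last first.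
  by apply: eq_bigr => x _; rewrite phiZ; case: ifP; rewrite (scale1r, scale0r).
rewrite -phi_sum; congr phi; apply: functional_extensionality_dep => l.
apply/matrixP => a b; rewrite summxE (bigD1 (bidx a)) //= [X in _ + X]big1 => [|x xa].
  by rewrite addr0 !mxE eqxx bidx_eq /= [b == a]eq_sym mulr_natr.
by rewrite !mxE [bidx a == x]eq_sym (negbTE xa) mulr0.
Qed.

End BlockUnits.

(** * Dimension of the finite-dimensional algebra *)

Section Dimension.
Variables (R : realType) (M : tracialWstar R).
Implicit Type D : set M.

(** By uniqueness of coordinates the two change of basis matrices multiply to the identity of size
    [N], which forces the inequality by rank. *)
Lemma has_dim_le D N N' : has_dim D N -> has_dim D N' -> (N <= N')%N.
Proof.
move=> [e [De he]] [f [Df hf]].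
have /choice [A hA] : forall i, exists a : {ffun 'I_N' -> R[i]}, e i = \sum_j a j *: f j.
  by move=> i; have [a [ha _]] := hf _ (De i); exists a.
have /choice [B hB] : forall j, exists a : {ffun 'I_N -> R[i]}, f j = \sum_i a i *: e i.
  by move=> j; have [a [ha _]] := he _ (Df j); exists a.
apply: (@mulmx1_min _ _ _ (\matrix_(i, j) A i j) (\matrix_(j, i) B j i)).
apply/matrixP => i l; rewrite !mxE.
have [a [_ ha]] := he _ (De i).
have /ffunP/(_ l) : [ffun l => \sum_j A i j * B j l] = [ffun l => (i == l)%:R].
  rewrite -(ha [ffun l => \sum_j A i j * B j l]).
    apply: ha; rewrite (bigD1 i) //= big1 ?addr0 => [|i' i'i].
      by rewrite ffunE eqxx scale1r.
    by rewrite ffunE eq_sym (negbTE i'i) scale0r.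
  rewrite {1}hA; under eq_bigr => j _ do rewrite {1}hB scaler_sumr.
  rewrite exchange_big; apply: eq_bigr => l' _; rewrite ffunE scaler_suml.
  by apply: eq_bigr => j _; rewrite scalerA.
by rewrite !ffunE => <-; apply: eq_bigr => j _; rewrite !mxE.
Qed.

Lemma has_dim_unique D N N' : has_dim D N -> has_dim D N' -> N = N'.
Proof. by move=> h h'; apply/eqP; rewrite eqn_leq !(has_dim_le (D := D)). Qed.

Lemma has_dim_finType D (I : finType) (f : I -> M) :
  (forall i, D (f i)) ->
  (forall x, D x -> exists! a : {ffun I -> R[i]}, x = \sum_i a i *: f i) ->
  has_dim D #|I|.
Proof.
move=> Df hf; exists (f \o enum_val); split=> [i|x Dx]; first exact: Df.
have [a [xa ua]] := hf x Dx.
exists [ffun i => a (enum_val i)]; split.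
  rewrite xa (reindex _ (onW_bij _ (@enum_val_bij I))).
  by apply: eq_bigr => i _; rewrite ffunE.
move=> b hb; have ab : a = [ffun i => b (enum_rank i)].
  apply: ua; rewrite hb (reindex _ (onW_bij _ (@enum_rank_bij I))).
  by apply: eq_bigr => i _; rewrite ffunE /= enum_rankK.
by apply/ffunP => i; rewrite ffunE ab ffunE enum_valK.
Qed.

End Dimension.

Lemma sum_tagged (V : zmodType) (I : finType) (J : I -> finType)
    (F : forall i, J i -> V) :
  \sum_i \sum_(a : J i) F i a = \sum_(p : {i : I & J i}) F (tag p) (tagged p).
Proof. exact: (sig_big_dep (fun=> true) (fun _ _ => true)). Qed.

Section BlockC.
Variables (R : realType) (M : tracialWstar R) (D : set M).
Variables (k : nat) (m : 'I_k -> nat) (phi : (forall j, 'M[R[i]]_(m j)) -> M).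
Hypothesis hphi : is_block_iso D phi.
Local Notation e := (block_unit phi).
Let eP := block_units hphi.

Lemma block_size_gt0 (x : block_index m) : (0 < m (tag x))%N.
Proof. by case: (hphi) => h _ _ _ _; exact: h. Qed.

(** Passes to pairs inside a common block, which label the nonzero units and hence a basis of
    [D]. *)
Lemma sum_same_block (V : zmodType) (F : block_index m -> block_index m -> V) :
  (forall x y, tag x != tag y -> F x y = 0) ->
  \sum_x \sum_y F x y =
  \sum_(p : {j : 'I_k & ('I_(m j) * 'I_(m j))%type})
     F (bidx (tagged p).1) (bidx (tagged p).2).
Proof.
move=> F0.
rewrite -(sum_tagged (fun j (p : 'I_(m j) * 'I_(m j)) => F (bidx p.1) (bidx p.2))).
transitivity (\sum_j \sum_(a < m j) \sum_y F (bidx a) y).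
  rewrite (sum_tagged (fun j (a : 'I_(m j)) => \sum_y F (bidx a) y)).
  by apply: eq_bigr => -[].
apply: eq_bigr => j _.
rewrite -(pair_big (fun=> true) (fun=> true) (fun a b => F (bidx a) (bidx b))) /=.
apply: eq_bigr => a _.
transitivity (\sum_l \sum_(b < m l) F (bidx a) (bidx b)).
  rewrite (sum_tagged (fun l (b : 'I_(m l)) => F (bidx a) (bidx b))).
  by apply: eq_bigr => -[].
rewrite (bigD1 j) //= [X in _ + X]big1 ?addr0 // => l lj.
by rewrite big1 // => b _; apply: F0; rewrite /= eq_sym.
Qed.

Lemma has_dim_blocks : has_dim D (\sum_j m j ^ 2).
Proof.
have -> : (\sum_j m j ^ 2 = #|{: {j : 'I_k & ('I_(m j) * 'I_(m j))%type}}|)%N.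
  by rewrite card_tagged sumnE big_map enumT; apply: eq_bigr => j _;
    rewrite card_prod card_ord.
apply: (has_dim_finType (f := fun p => e (bidx (tagged p).1) (bidx (tagged p).2))).
  by move=> p; exact: (mu_mem eP).
move=> d Dd; have [c hc] := mu_span eP Dd.
have {}hc : d = \sum_(p : {j : 'I_k & ('I_(m j) * 'I_(m j))%type})
    c (bidx (tagged p).1) (bidx (tagged p).2) *: e (bidx (tagged p).1) (bidx (tagged p).2).
  rewrite hc sum_same_block // => x y xy.
  by rewrite (mu_offblock eP) // scaler0.
exists [ffun p : {j : 'I_k & ('I_(m j) * 'I_(m j))%type} =>
  c (bidx (tagged p).1) (bidx (tagged p).2)]; split.
  by rewrite hc; apply: eq_bigr => p _; rewrite ffunE.
(* The trace against the transposed unit recovers each coordinate; this gives uniqueness. *)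
have coef (a : {ffun {j : 'I_k & ('I_(m j) * 'I_(m j))%type} -> R[i]}) p :
    d = \sum_p a p *: e (bidx (tagged p).1) (bidx (tagged p).2) ->
    a p = tau (d * e (bidx (tagged p).2) (bidx (tagged p).1)) / wt e (bidx (tagged p).1).
  move=> ->; rewrite big_distrl /= tau_sum (bigD1 p) //= [X in _ + X]big1 => [|q qp].
    by rewrite addr0 -scalerAl tauZ (mu_mul_mid eP) // mulfK // (wt_neq0 eP).
  rewrite -scalerAl (mu_mul eP) scalerA tauZ (tau_mu eP).
  suff : (bidx (tagged q).2 == bidx (tagged p).2) &&
         (bidx (tagged q).1 == bidx (tagged p).1) = false.
    by case: (_ == bidx (tagged p).2) => //= [->|_]; rewrite ?mul0r ?mulr0 ?mul0r.
  apply: contraNF qp => /andP[].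
  case: q p => j [a1 a2] [l [b1 b2]] /= h.
  have jl : j = l by have := congr1 tag (eqP h).
  by case: l / jl b1 b2 h => b1 b2; rewrite !bidx_eq => /eqP -> /eqP ->.
move=> a ha; apply/ffunP => p; rewrite (coef a p ha) ffunE.
rewrite -(coef [ffun p => c (bidx (tagged p).1) (bidx (tagged p).2)] p) ?ffunE //.
by rewrite hc; apply: eq_bigr => q _; rewrite ffunE.
Qed.

Variable dimD : nat.
Hypothesis hdim : has_dim D dimD.

Lemma dim_blocks : dimD = (\sum_j m j ^ 2)%N.
Proof. exact: has_dim_unique hdim has_dim_blocks. Qed.

Lemma dim_neq0 (x : block_index m) : dimD%:R != 0 :> R[i].
Proof.
rewrite pnatr_eq0 dim_blocks (bigD1 (tag x)) //= addn_eq0 negb_and.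
by rewrite -lt0n expn_gt0 block_size_gt0.
Qed.

Lemma tau_block_proj x :
  tau (block_proj phi (tag x)) = (m (tag x))%:R * wt e x.
Proof.
rewrite (block_projE hphi) tau_sum.
transitivity (\sum_(y : block_index m) if tag y == tag x then wt e x else 0).
  rewrite big_mkcond; apply: eq_bigr => y _.
  by case: eqP => // yx; exact: (wt_block eP).
rewrite -(sum_tagged (fun j (a : 'I_(m j)) => if j == tag x then wt e x else 0)).
rewrite (bigD1 (tag x)) //= [X in _ + X]big1 ?addr0 => [|j /negbTE jx].
  by rewrite eqxx sumr_const card_ord mulr_natl.
by apply: big1 => a _; rewrite jx.
Qed.

Lemma block_cE :
  block_c phi = \sum_x (dimD%:R * wt e x / (m (tag x))%:R) *: e x x.
Proof.
rewrite /block_c -dim_blocks scaler_sumr.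
transitivity (\sum_j \sum_(x | tag x == j) (dimD%:R * wt e x / (m (tag x))%:R) *: e x x).
  apply: eq_bigr => j _; rewrite (block_projE hphi) -(block_projE hphi) scalerA.
  rewrite {2}(block_projE hphi) scaler_sumr; apply: eq_bigr => x /eqP xj.
  rewrite -xj tau_block_proj; congr (_ *: _).
  have m0 : (m (tag x))%:R != 0 :> R[i].
    by rewrite pnatr_eq0 -lt0n block_size_gt0.
  (* The trace of the central projection is block size times weight, so one factor of the squared
     block size cancels. *)
  by rewrite natrX -[RHS]mulrA; congr (_ * _); rewrite expr2 invfM mulrACA mulfV // mul1r.
by rewrite [RHS](partition_big (fun x : block_index m => tag x) predT).
Qed.

Definition block_cinv := \sum_x ((m (tag x))%:R / (dimD%:R * wt e x)) *: e x x.

Lemma diag_mul (f g : block_index m -> R[i]) :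
  (\sum_x f x *: e x x) * (\sum_x g x *: e x x) = \sum_x (f x * g x) *: e x x.
Proof.
rewrite big_distrl /=; apply: eq_bigr => x _.
rewrite big_distrr /= (bigD1 x) //= [X in _ + X]big1 => [|y yx].
  by rewrite addr0 -scalerAl -scalerAr scalerA (mu_mul_mid eP).
by rewrite -scalerAl -scalerAr (mu_mul eP) eq_sym (negbTE yx) scale0r !scaler0.
Qed.

(** The inverse is characterised only on units, so an explicit two-sided inverse is exhibited before
    being identified with it. *)
Lemma block_c_unit : block_c phi \is a GRing.unit /\ (block_c phi)^-1 = block_cinv.
Proof.
have nz x : dimD%:R * wt e x / (m (tag x))%:R != 0.
  rewrite mulf_neq0 ?mulf_neq0 ?(dim_neq0 x) ?(wt_neq0 eP) // invr_eq0.
  by rewrite pnatr_eq0 -lt0n block_size_gt0.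
have h1 : block_c phi * block_cinv = 1.
  rewrite block_cE diag_mul -(mu_one eP); apply: eq_bigr => x _.
  by rewrite -[_ / (_ * _)]invf_div mulfV // scale1r.
have h2 : block_cinv * block_c phi = 1.
  rewrite block_cE diag_mul -(mu_one eP); apply: eq_bigr => x _.
  by rewrite -[_ / (_ * _)]invf_div mulVf // scale1r.
have u : block_c phi \is a GRing.unit by apply/unitrP; exists block_cinv.
by split=> //; apply: (mulrI u); rewrite divrr.
Qed.

Lemma mul_block_cinv x y :
  e x y * block_cinv = ((m (tag y))%:R / (dimD%:R * wt e y)) *: e x y.
Proof.
rewrite big_distrr /= (bigD1 y) //= [X in _ + X]big1 => [|z zy]; last first.
  by rewrite -scalerAr (mu_mul eP) eq_sym (negbTE zy) scale0r scaler0.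
rewrite addr0 -scalerAr.
have [xy|xy] := eqVneq (tag x) (tag y); first by rewrite (mu_mul_mid eP).
by rewrite (mu_offblock eP xy) mul0r.
Qed.

End BlockC.

(** * Averaging over the unitary group *)

Section Subalgebra.
Variables (R : realType) (M : tracialWstar R) (A : set M).
Hypothesis hA : subalgebra A.

Lemma subalgebra1 : A 1. Proof. by case: hA. Qed.

Lemma subalgebraM a b : A a -> A b -> A (a * b).
Proof. by case: hA => _ _; exact. Qed.

Lemma subalgebraD a b : A a -> A b -> A (a + b).
Proof. by case: hA => _ h _ Aa Ab; have := h 1 a b Aa Ab; rewrite scale1r. Qed.

Lemma subalgebra0 : A 0.
Proof.
by case: hA => A1 h _; have := h (-1) 1 1 A1 A1; rewrite scaleN1r addNr.
Qed.

Lemma subalgebraZ (c : R[i]) a : A a -> A (c *: a).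
Proof. by case: hA => _ h _ Aa; have := h c a 0 Aa subalgebra0; rewrite addr0. Qed.

Lemma subalgebraB a b : A a -> A b -> A (a - b).
Proof. by move=> Aa Ab; rewrite -scaleN1r; apply: subalgebraD => //; exact: subalgebraZ. Qed.

Lemma subalgebra_sum (I : finType) (F : I -> M) :
  (forall i, A (F i)) -> A (\sum_i F i).
Proof. by move=> AF; apply: big_ind => //; [exact: subalgebra0 | exact: subalgebraD]. Qed.

End Subalgebra.

Section Averaging.
Variables (R : realType) (M : tracialWstar R) (L : L2space M) (D : set M).
Variables (K T : finType) (blk : T -> K) (e : T -> T -> M).
Hypothesis eP : matrix_units D blk e.
Hypothesis hD : star_subalgebra D.

Definition block_size x := #|[pred y | blk y == blk x]|.

(** The orthogonal projection of L^2 onto the vectors commuting with [D]. *)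
Definition commutant_proj (xi : L) : L :=
  \sum_x \sum_y (block_size x)%:R^-1 *: ract (lact (e x y) xi) (e y x).

Lemma unitary_involution v : D v -> star v = v -> v * v = 1 -> unitary_group D v.
Proof. by move=> Dv sv vv; split=> //; rewrite sv. Qed.

Lemma reflection_unitary x : unitary_group D (1 - (e x x + e x x)).
Proof.
have De := mu_mem eP; have sD := hD.1; apply: unitary_involution.
- by apply: subalgebraB => //; [exact: subalgebra1 | exact: subalgebraD].
- by rewrite starB star1 starD !(mu_star eP).
- rewrite mulrBr mulr1 mulrBl mul1r mulrDl !mulrDr !(mu_mul_mid eP) //.
  by rewrite opprB addrK subrK.
Qed.

Lemma swap_unitary x y : blk x = blk y -> x != y ->
  unitary_group D (1 + (e x y + e y x - (e x x + e y y))).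
Proof.
move=> xy nxy; have De := mu_mem eP; have sD := hD.1.
have nyx : y != x by rewrite eq_sym.
apply: unitary_involution.
- apply: subalgebraD => //; first exact: subalgebra1.
  by apply: subalgebraB => //; exact: subalgebraD.
- by rewrite starD starB star1 !starD !(mu_star eP) [e y x + _]addrC.
- have yx := esym xy.
  (* [s] is the flip on the range of the projection [t], so [1 + s - t] exchanges [x] and [y] and is
     the identity elsewhere. *)
  set s := e x y + e y x; set t := e x x + e y y.
  have ss : s * s = t.
    rewrite mulrDl !mulrDr (mu_mul_neq eP x y nyx) (mu_mul_neq eP y x nxy).
    by rewrite !(mu_mul_mid eP) // add0r addr0.
  have st : s * t = s.
    rewrite mulrDl !mulrDr (mu_mul_neq eP x x nyx) (mu_mul_neq eP y y nxy).
    by rewrite !(mu_mul_mid eP) // add0r addr0.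
  have ts : t * s = s.
    rewrite mulrDl !mulrDr (mu_mul_neq eP x x nxy) (mu_mul_neq eP y y nyx).
    by rewrite !(mu_mul_mid eP) // add0r addr0.
  have tt : t * t = t.
    rewrite mulrDl !mulrDr (mu_mul_neq eP x y nxy) (mu_mul_neq eP y x nyx).
    by rewrite !(mu_mul_mid eP) // add0r addr0.
  rewrite mulrDl mul1r mulrDr mulr1 mulrBl !mulrBr ss st ts tt.
  by rewrite -(opprB s t) [X in _ + X]addrA subrr sub0r addrK.
Qed.

Section Invariant.
Variable G : L -> R[i].
Hypothesis GD : forall xi eta, G (xi + eta) = G xi + G eta.
Hypothesis Ginv : forall v xi, unitary_group D v -> G (ract (lact (star v) xi) v) = G xi.

Lemma invariant0 : G 0 = 0.
Proof. by apply: (addrI (G 0)); rewrite -GD !addr0. Qed.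

Lemma invariant_sum (I : finType) (P : pred I) (F : I -> L) :
  G (\sum_(i | P i) F i) = \sum_(i | P i) G (F i).
Proof. exact: (big_morph G GD invariant0). Qed.

(* Conjugation by the reflection 1 - 2 e_xx changes the sign of
   e_xx xi (1 - e_xx), so G vanishes there. *)
Lemma invariant_corner x xi : G (lact (e x x) xi) = G (ract (lact (e x x) xi) (e x x)).
Proof.
pose z := ract (lact (e x x) xi) (1 - e x x).
transitivity (G (z + ract (lact (e x x) xi) (e x x))).
  by rewrite -ractDr subrK ract1.
rewrite GD -[RHS]add0r; congr (_ + _).
have /(_ z) := Ginv _ (reflection_unitary x).
rewrite starB star1 starD !(mu_star eP) {1}/z lact_ract -lactM -ractM.
have -> : (1 - (e x x + e x x)) * e x x = - e x x.
  by rewrite mulrBl mul1r mulrDl (mu_mul_mid eP) // opprD addrA subrr sub0r.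
have -> : (1 - e x x) * (1 - (e x x + e x x)) = 1 - e x x.
  rewrite mulrBr mulr1 mulrDr mulrBl mul1r (mu_mul_mid eP) //.
  by rewrite subrr addr0 subr0.
rewrite lactNl ractNl -/z => hz.
have : G z + G z = 0 by rewrite -{1}hz -GD addNr invariant0.
by move/eqP; rewrite -mulr2n mulrn_eq0 => /eqP.
Qed.

Lemma invariant_swap x y xi : blk x = blk y ->
  G (ract (lact (e x x) xi) (e x x)) = G (ract (lact (e y x) xi) (e x y)).
Proof.
move=> xy; have [->//|nxy] := eqVneq x y.
have nyx : y != x by rewrite eq_sym.
have vl : (1 + (e x y + e y x - (e x x + e y y))) * e x x = e y x.
  rewrite mulrDl mul1r mulrBl !mulrDl (mu_mul_neq eP x x nyx).
  by rewrite (mu_mul_neq eP y x nyx) !(mu_mul_mid eP) // !addr0 add0r addrC subrK.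
have vr : e x x * (1 + (e x y + e y x - (e x x + e y y))) = e x y.
  rewrite mulrDr mulr1 mulrBr !mulrDr (mu_mul_neq eP x x nxy).
  by rewrite (mu_mul_neq eP x y nxy) !(mu_mul_mid eP) // !addr0 addrC subrK.
rewrite -(Ginv _ (swap_unitary xy nxy)).
have -> : star (1 + (e x y + e y x - (e x x + e y y))) =
    1 + (e x y + e y x - (e x x + e y y)).
  by rewrite starD starB star1 !starD !(mu_star eP) [e y x + _]addrC.
by rewrite lact_ract -lactM -ractM vl vr.
Qed.

Lemma invariant_proj xi : G xi = G (commutant_proj xi).
Proof.
transitivity (\sum_x G (ract (lact (e x x) xi) (e x x))).
  rewrite -{1}[xi]lact1 -(mu_one eP) lact_suml invariant_sum.
  by apply: eq_bigr => x _; exact: invariant_corner.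
(* Additivity is enough to divide by an integer. Full linearity would be too much to ask: the
   averaged functional is conjugate-linear. *)
have Gn (n : nat) eta : (0 < n)%N -> G eta = G (n%:R^-1 *: eta) *+ n.
  move=> n0; transitivity (G (\sum_(i < n) n%:R^-1 *: eta)).
    rewrite sumr_const card_ord -scaler_nat scalerA mulfV ?scale1r //.
    by rewrite pnatr_eq0 -lt0n.
  by rewrite invariant_sum sumr_const card_ord.
have n0 x : (0 < block_size x)%N by apply/card_gt0P; exists x; rewrite inE.
(* Each diagonal corner is cut into equal parts, one for every index of its block; the swaps then
   move each part to its own index. *)
transitivity (\sum_y \sum_(x | blk x == blk y)
    G ((block_size y)%:R^-1 *: ract (lact (e y y) xi) (e y y))).
  by apply: eq_bigr => x _; rewrite sumr_const -Gn.
rewrite (exchange_big_dep predT) //= invariant_sum; apply: eq_bigr => x _.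
rewrite invariant_sum big_mkcond /=; apply: eq_bigr => y _.
have [xy|xy] := eqVneq (blk x) (blk y); last first.
  by rewrite (mu_offblock eP xy) lact0l ract0l scaler0 invariant0.
rewrite /block_size xy -/(block_size y).
by rewrite -!ractZl -!lactZr; apply: invariant_swap.
Qed.

End Invariant.

Lemma commutant_proj_comm d xi : D d ->
  lact d (commutant_proj xi) = ract (commutant_proj xi) d.
Proof.
move=> /(mu_span eP) [c ->]; rewrite lact_suml ract_sumr; apply: eq_bigr => z _.
rewrite lact_suml ract_sumr; apply: eq_bigr => w _.
rewrite lactZl ractZr; congr (_ *: _).
have [zw|zw] := eqVneq (blk z) (blk w); last by rewrite (mu_offblock eP zw) lact0l ract0r.
(* Multiplying the projection by [e z w] on either side collapses one index and leaves this same
   sum. *)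
transitivity (\sum_y (block_size w)%:R^-1 *: ract (lact (e z y) xi) (e y w)).
  rewrite lact_sumr (bigD1 w) //= [X in _ + X]big1 ?addr0 => [|x xw].
    rewrite lact_sumr; apply: eq_bigr => y _.
    by rewrite lactZr lact_ract -lactM (mu_mul_mid eP).
  rewrite lact_sumr big1 // => y _.
  by rewrite lactZr lact_ract -lactM (mu_mul eP) eq_sym (negbTE xw) scale0r lact0l
    ract0l scaler0.
rewrite ract_suml [RHS](bigD1 z) //= [X in _ + X]big1 ?addr0 => [|x xz].
  rewrite ract_suml; apply: eq_bigr => y _.
  rewrite ractZl -ractM /block_size zw; congr (_ *: _).
  have [yz|yz] := eqVneq (blk y) (blk z); first by rewrite (mu_mul_mid eP).
  have yw : blk y != blk w by rewrite -zw.
  by rewrite (mu_offblock eP yz) (mu_offblock eP yw) mul0r.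
rewrite ract_suml big1 // => y _.
by rewrite ractZl -ractM (mu_mul eP) (negbTE xz) scale0r ract0r scaler0.
Qed.

(** Taking adjoints exchanges the two indices of the units, and the weight is symmetric because it
    depends only on the block. *)
Lemma dot_commutant_proj xi eta :
  L2dot L (commutant_proj xi) eta = L2dot L xi (commutant_proj eta).
Proof.
rewrite (dot_suml (L2dotP L)) (dot_sumr (L2dotP L)).
under eq_bigr => x _ do rewrite (dot_suml (L2dotP L)).
under [RHS]eq_bigr => x _ do rewrite (dot_sumr (L2dotP L)).
rewrite exchange_big /=; apply: eq_bigr => y _; apply: eq_bigr => x _.
rewrite (dotZl (L2dotP L)) (dotZr (L2dotP L)) dot_ract dot_lact !(mu_star eP).
have [xy|xy] := eqVneq (blk x) (blk y); last first.
  have yx : blk y != blk x by rewrite eq_sym.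
  by rewrite (mu_offblock eP yx) !lact0l ract0l (dot0r (L2dotP L)) !mulr0.
rewrite lact_ract; congr (_ * _).
by rewrite /block_size xy; apply: esym; rewrite fmorphV; congr (_^-1); apply: rmorph_nat.
Qed.

End Averaging.

Section ComplexParts.
Variable R : realType.
Implicit Types x y : R[i].

Lemma ReM x y :
  complex.Re (x * y) = complex.Re x * complex.Re y - complex.Im x * complex.Im y.
Proof. by case: x y => a b [c d]. Qed.

Lemma ImM x y :
  complex.Im (x * y) = complex.Re x * complex.Im y + complex.Im x * complex.Re y.
Proof. by case: x y => a b [c d]. Qed.

Lemma ReJ x : complex.Re x^*%C = complex.Re x.
Proof. by case: x. Qed.

Lemma ImJ x : complex.Im x^*%C = - complex.Im x.
Proof. by case: x. Qed.

End ComplexParts.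

(** * Measurability and invariance on the unitary group *)

Section HaarMeasure.
Variables (R : realType) (M : tracialWstar R) (L : L2space M) (D : set M).
Variables (K T : finType) (blk : T -> K) (e : T -> T -> M).
Hypothesis eP : matrix_units D blk e.
Hypothesis hD : star_subalgebra D.
Variable E : M -> M.
Hypothesis hE : cond_exp D E.
Hypothesis htauE : forall x, tau (E x) = tau x.
Local Notation emb := (L2emb L).
Local Notation dot := (L2dot L).
Local Notation U := (unitary_group D).

Lemma L2emb_inj (x y : M) : emb x = emb y -> x = y.
Proof.
move=> xy; apply/eqP; rewrite -subr_eq0; apply/eqP; set z := x - y.
have nz : `|emb z| ^+ 2 = 0 by rewrite embB xy subrr normr0 expr0n.
have zz : star z * z = 0.
  apply: tau_faithful; first exact: positive_star_mul.
  by rewrite tau_trace -(norm_emb L).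
apply: (@vn_pi_inj _ M); apply/funext => u.
have pi0 v : vn_pi M 0 v = 0 by rewrite -(subrr 0) vn_piB subrr.
rewrite pi0; apply/eqP; rewrite -normr_eq0 -sqrf_eq0 -(dot_norm (vn_dotP M)).
by rewrite -vn_dot_star_mul zz pi0 (dot0l (vn_dotP M)).
Qed.

Lemma measurable_preimage_emb (O : set L) : open O ->
  measurable (emb @^-1` O : set (borelM L)).
Proof. by move=> oO; apply: sub_sigma_algebra; exists O. Qed.

Lemma measurable_closed_preimage_emb (C : set L) : closed C ->
  measurable (emb @^-1` C : set (borelM L)).
Proof.
move=> cC; rewrite -[X in measurable X]setCK; apply: measurableC.
exact: (@measurable_preimage_emb (~` C) (closed_openC cC)).
Qed.

Lemma closed_eq_fun (V : normedModType R[i]) (f g : L -> V) :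
  continuous f -> continuous g -> closed [set xi | f xi = g xi].
Proof.
move=> cf cg.
have -> : [set xi | f xi = g xi] = (fun xi => f xi - g xi) @^-1` [set 0].
  apply/seteqP; split=> xi /= => [->|/eqP]; first by rewrite subrr.
  by rewrite subr_eq0 => /eqP.
apply: preimage_closed; last first.
  exact: accessible_closed_set1 (hausdorff_accessible (@norm_hausdorff _ V)) _.
by move=> xi _; apply: cvgB; [exact: cf | exact: cg].
Qed.

(** Testing with [1] and [h] shows that the traces of [h] and of its cube vanish; testing with
    [1 + h] then leaves twice the trace of the square of [h], and faithfulness applies. *)
Lemma selfadjoint_eq0 (h : M) :
  star h = h -> (forall a, tau (star a * a * h) = 0) -> h = 0.
Proof.
move=> sh th.
have t1 : tau h = 0 by have := th 1; rewrite star1 !mul1r.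
have t2 := th h; have t3 := th (1 + h).
rewrite sh in t2; rewrite starD star1 sh -mulrA in t3.
have e3 : (1 + h) * ((1 + h) * h) = h + h * h + (h * h + h * h * h).
  by rewrite (mulrDl 1 h h) mul1r mulrDl mul1r mulrDr mulrA.
rewrite e3 !tauD t1 t2 add0r addr0 in t3.
have {t3} : tau (star h * h) = 0.
  by move/eqP: t3; rewrite sh -mulr2n mulrn_eq0 => /eqP.
move/(tau_faithful (positive_star_mul h)) => hh.
apply: L2emb_inj; rewrite emb0; apply/eqP; rewrite -normr_eq0 -sqrf_eq0 norm_emb.
by rewrite tau_trace hh tau0.
Qed.

Lemma mul_star_eq1 (u : M) :
  (forall a, tau (star a * a * (u * star u)) = tau (star a * a)) -> u * star u = 1.
Proof.
move=> hu; apply/eqP; rewrite -subr_eq0; apply/eqP; apply: selfadjoint_eq0.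
  by rewrite starB starM starK star1.
by move=> a; rewrite mulrBr mulr1 tauB hu subrr.
Qed.

(** A tracial algebra is finite: [1 - star u * u] is a projection, and its trace is zero. *)
Lemma star_mul_eq1 (u : M) : u * star u = 1 -> star u * u = 1.
Proof.
move=> uu.
set h := 1 - star u * u.
have sh : star h = h by rewrite starB starM starK star1.
have hh : star h * h = h.
  rewrite sh /h mulrBr mulr1 mulrBl mul1r [X in _ - (_ - X)](_ : _ = star u * u).
    by rewrite subrr subr0.
  by rewrite mulrA -(mulrA (star u)) uu mulr1.
suff : h = 0 by move/eqP; rewrite subr_eq0 eq_sym => /eqP.
rewrite -hh; apply: tau_faithful; first exact: positive_star_mul.
by rewrite hh tauB tau1 tau_trace uu tau1 subrr.
Qed.

(** The product [u * star u] is not visibly L^2-continuous in [u]. Isometry of right multiplication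
    by [u] expresses unitarity through one L^2-closed condition for each [a], and an arbitrary
    intersection of closed sets is closed. *)
Lemma unitary_groupE : (U : set (borelM L)) =
  emb @^-1` ([set xi | E2 E xi = xi] `&`
    \bigcap_(a in [set: M]) [set xi | `|lact a xi| = `|emb a|]).
Proof.
have D1 := subalgebra1 hD.1.
apply/seteqP; split=> u /=.
  move=> [Du u1 u2]; split; first by rewrite (E2_emb _ eP D1 hE htauE) (cond_exp_id D1 hE).
  move=> a _ /=; rewrite lact_emb; apply/eqP.
  rewrite -(@eqrXn2 _ 2) // !norm_emb starM !mulrA -(mulrA a) u2 mulr1.
  exact: eqxx.
move=> [Eu hu]; have Du : D u.
  have /L2emb_inj <- : emb (E u) = emb u by rewrite -(E2_emb _ eP D1 hE htauE).
  by case: hE.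
have uu : u * star u = 1.
  apply: mul_star_eq1 => a.
  have /= := hu a I; rewrite lact_emb => /(congr1 (fun x => x ^+ 2)).
  rewrite !norm_emb starM => h; rewrite [tau (star a * a)]tau_trace -h.
  by rewrite -!mulrA tau_trace !mulrA.
by split=> //; exact: star_mul_eq1.
Qed.

Lemma measurable_unitary_group : measurable (U : set (borelM L)).
Proof.
rewrite unitary_groupE; apply: measurable_closed_preimage_emb.
apply: closedI.
  apply: closed_eq_fun; first exact: (E2_continuous eP (subalgebra1 hD.1) hE htauE).
  by move=> xi; exact: cvg_id.
apply: closed_bigI => a _.
apply: (@closed_eq_fun R[i]^o) => xi; last exact: cvg_cst.
by apply: cvg_norm; exact: lact_continuous.
Qed.

Definition lmul (v : M) : borelM L -> borelM L := fun u => v * u.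

Lemma measurable_lmul (v : M) : measurable_fun [set: borelM L] (lmul v).
Proof.
apply: (@measurability _ _ (borelM L) (borelM L) setT (lmul v) (@L2borel R M L)).
  by [].
move=> _ [_ [Q oQ <-] <-].
rewrite setTI.
have -> : lmul v @^-1` (emb @^-1` Q) = emb @^-1` (lact v @^-1` Q).
  by apply/seteqP; split=> u /=; rewrite lact_emb.
apply: measurable_preimage_emb; apply: open_comp => // xi _.
exact: lact_continuous.
Qed.

Variable mu : probability (borelM L) R.
Hypothesis hmu : is_haar D mu.

Lemma unitary_lmul (v u : M) : U v -> U (v * u) <-> U u.
Proof.
have DM := subalgebraM hD.1.
have UM (a b : M) : U a -> U b -> U (a * b).
  move=> [Da a1 a2] [Db b1 b2]; split; first exact: DM.
    by rewrite starM -mulrA (mulrA (star a)) a1 mul1r.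
  by rewrite starM -mulrA (mulrA b) b2 mul1r.
move=> Uv; split=> [Uvu|]; last exact: UM.
have -> : u = star v * (v * u) by case: Uv => _ h _; rewrite mulrA h mul1r.
apply: UM => //; case: Uv => Dv v1 v2.
by split; [exact: hD.2 | rewrite starK | rewrite starK].
Qed.

Lemma bounded_integrable (f : borelM L -> R) (B : R) :
  measurable_fun [set: borelM L] f -> (forall u, U u -> `|f u| <= B) ->
  mu.-integrable U (EFin \o f).
Proof.
move=> mf fB; apply: measurable_bounded_integrable.
- exact: measurable_unitary_group.
- by apply: (le_lt_trans (probability_le1 _ _)); [exact: measurable_unitary_group | exact: ltry].
- exact: measurable_funTS.
- exists B; split; first exact: num_real.
  by move=> r Br u Uu; apply: (le_trans (fB u Uu)); exact: ltW.
Qed.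

Lemma haar_invariant (v : M) (f : borelM L -> R) (B : R) : U v ->
  measurable_fun [set: borelM L] f -> (forall u, U u -> `|f u| <= B) ->
  \int[mu]_(u in U) f (lmul v u) = \int[mu]_(u in U) f u.
Proof.
move=> Uv mf fB.
have mU := measurable_unitary_group.
have preU : lmul v @^-1` (U : set (borelM L)) = U.
  by apply/seteqP; split=> u /=; rewrite (unitary_lmul u Uv).
have int' : mu.-integrable U (EFin \o (f \o lmul v)).
  apply: (bounded_integrable (B := B)).
    exact: (measurableT_comp mf (measurable_lmul v)).
  by move=> u /(unitary_lmul u Uv); exact: fB.
rewrite /Rintegral; congr fine.
(* Left invariance says exactly that this pushforward agrees with [mu] on measurable sets. *)
transitivity (\int[pushforward mu (lmul v)]_(u in (U : set (borelM L))) (f u)%:E)%E.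
  rewrite integral_pushforward ?preU //; first exact: measurable_lmul.
  exact/measurable_EFinP.
apply: (eq_measure_integral mu).
  exact: measurable_lmul.
by move=> mv A mA _; exact: hmu.2.
Qed.

Definition cmeasurable (f : borelM L -> R[i]) :=
  measurable_fun [set: borelM L] (fun u => complex.Re (f u)) /\
  measurable_fun [set: borelM L] (fun u => complex.Im (f u)).

Lemma cmeasurable_cst (c : R[i]) : cmeasurable (fun=> c).
Proof. by split; exact: measurable_cst. Qed.

Lemma cmeasurableD f g : cmeasurable f -> cmeasurable g ->
  cmeasurable (fun u => f u + g u).
Proof.
move=> [f1 f2] [g1 g2]; split.
  under eq_fun do rewrite raddfD.
  exact: measurable_funD.
under eq_fun do rewrite raddfD.
exact: measurable_funD.
Qed.

Lemma cmeasurableM f g : cmeasurable f -> cmeasurable g ->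
  cmeasurable (fun u => f u * g u).
Proof.
move=> [f1 f2] [g1 g2]; split.
  under eq_fun do rewrite ReM.
  by apply: measurable_funB; exact: measurable_funM.
under eq_fun do rewrite ImM.
by apply: measurable_funD; exact: measurable_funM.
Qed.

Lemma cmeasurable_conj f : cmeasurable f -> cmeasurable (fun u => (f u)^*%C).
Proof.
move=> [f1 f2]; split; first by under eq_fun do rewrite ReJ.
under eq_fun do rewrite ImJ.
exact: measurable_funN.
Qed.

Lemma cmeasurable_sum (I : finType) (f : I -> borelM L -> R[i]) :
  (forall i, cmeasurable (f i)) -> cmeasurable (fun u => \sum_i f i u).
Proof.
move=> mf.
have h (r : seq I) : cmeasurable (fun u => \sum_(i <- r) f i u).
  elim: r => [|i r IH].
    by under eq_fun do rewrite big_nil; exact: cmeasurable_cst.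
  by under eq_fun do rewrite big_cons; exact: cmeasurableD.
exact: h.
Qed.

Lemma measurable_open_fun (f : L -> R^o) :
  continuous f -> measurable_fun [set: borelM L] (f \o emb).
Proof.
move=> cf; apply: (@measurability _ _ (borelM L) _ setT _ _ (RGenOpens.measurableE R)).
move=> _ [_ [a [b ->] <-]]; rewrite setTI comp_preimage.
apply: measurable_preimage_emb; apply: open_comp => [xi _|]; first exact: cf.
exact: interval_open.
Qed.

Lemma continuous_Re_dot (eta : L) :
  continuous ((fun xi => complex.Re (dot xi eta)) : L -> R^o).
Proof.
move=> xi; apply/cvgrPdist_lt => eps eps0.
have d0 : 0 < eps%:C%C / (`|eta| + 1).
  by rewrite divr_gt0 ?ltcR // ltr_wpDl.
near=> zeta.
rewrite -ltcR; apply: (@le_lt_trans _ _ `|dot xi eta - dot zeta eta|).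
  rewrite -raddfB; case: (dot xi eta - _) => a b /=.
  rewrite normc_def; rewrite lecR; rewrite -sqrtr_sqr; rewrite ler_wsqrtr //.
  by rewrite lerDl sqr_ge0.
rewrite -(dotBl (L2dotP L)).
apply: (le_lt_trans (cauchy_schwarz (L2dotP L) _ _)).
apply: (@le_lt_trans _ _ (`|xi - zeta| * (`|eta| + 1))).
  by rewrite ler_wpM2l // lerDl.
rewrite -ltr_pdivlMr ?ltr_wpDl //; near: zeta.
Unshelve. all: by end_near. Qed.

Lemma cmeasurable_dot (eta : L) : cmeasurable (fun u => dot (emb u) eta).
Proof.
split.
  exact: (@measurable_open_fun (fun xi => complex.Re (dot xi eta)) (@continuous_Re_dot _)).
(* The form is conjugate-linear in its second argument, so the factor ['i] comes out as [-'i] and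
   turns real into imaginary parts. *)
have -> : (fun u : borelM L => complex.Im (dot (emb u) eta)) =
    (fun xi => complex.Re (dot xi ('i%C *: eta))) \o emb.
  apply/funext => u /=; rewrite (dotZr (L2dotP L)) ReM /=.
  by rewrite mul0r mulN1r sub0r opprK.
exact: (measurable_open_fun (@continuous_Re_dot _)).
Qed.

End HaarMeasure.

Section HaarAverage.
Variables (R : realType) (M : tracialWstar R) (L : L2space M) (D : set M).
Variables (K T : finType) (blk : T -> K) (e : T -> T -> M).
Hypothesis eP : matrix_units D blk e.
Hypothesis hD : star_subalgebra D.
Variable E : M -> M.
Hypothesis hE : cond_exp D E.
Hypothesis htauE : forall x, tau (E x) = tau x.
Local Notation emb := (L2emb L).
Local Notation dot := (L2dot L).
Local Notation U := (unitary_group D).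

Variable mu : probability (borelM L) R.
Hypothesis hmu : is_haar D mu.

Local Notation cmeasurable := (@cmeasurable R M L).
Let Eid a : D a -> E a = a := cond_exp_id (subalgebra1 hD.1) hE (a := a).
Let mU := measurable_unitary_group (L := L) eP hD hE htauE.

Lemma eq_cintegral (f g : M -> R[i]) : (forall u, U u -> f u = g u) ->
  cintegral D mu f = cintegral D mu g.
Proof.
move=> fg; rewrite /cintegral.
have -> : \int[mu]_(u in U) complex.Re (f u) = \int[mu]_(u in U) complex.Re (g u).
  by apply: eq_Rintegral => u /set_mem Uu; rewrite fg.
have -> // : \int[mu]_(u in U) complex.Im (f u) = \int[mu]_(u in U) complex.Im (g u).
by apply: eq_Rintegral => u /set_mem Uu; rewrite fg.
Qed.

Definition orbit_coef (xi eta : L) (u : M) : R[i] :=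
  dot (ract (lact u xi) (star u)) eta.

(* Composition with E, which is harmless on the unitary group, turns the
   coefficient into a polynomial in the coordinates of E u. *)
Lemma cmeasurable_orbit xi eta : cmeasurable (fun u => orbit_coef xi eta (E u)).
Proof.
pose c x y (u : M) := dot (emb u) (emb (e x y)) / wt e x.
have mc x y : cmeasurable (c x y).
  by apply: cmeasurableM; [exact: cmeasurable_dot | exact: cmeasurable_cst].
have Ec u : E u = \sum_x \sum_y c x y u *: e x y.
  rewrite (cond_exp_mu eP (subalgebra1 hD.1) hE htauE).
  apply: eq_bigr => x _; apply: eq_bigr => y _.
  by rewrite /c L2emb_dot (mu_star eP).
have -> : (fun u : borelM L => orbit_coef xi eta (E u)) = (fun u =>
    \sum_x \sum_y \sum_z \sum_w c x y u * (c z w u)^*%C *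
      dot (ract (lact (e x y) xi) (e w z)) eta).
  apply/funext => u; rewrite /orbit_coef Ec.
  rewrite lact_suml ract_suml (dot_suml (L2dotP L)); apply: eq_bigr => x _.
  rewrite lact_suml ract_suml (dot_suml (L2dotP L)); apply: eq_bigr => y _.
  rewrite star_sum ract_sumr (dot_suml (L2dotP L)); apply: eq_bigr => z _.
  rewrite star_sum ract_sumr (dot_suml (L2dotP L)); apply: eq_bigr => w _.
  rewrite starZ (mu_star eP) lactZl ractZl ractZr !(dotZl (L2dotP L)).
  by rewrite mulrA.
apply: cmeasurable_sum => x; apply: cmeasurable_sum => y.
apply: cmeasurable_sum => z; apply: cmeasurable_sum => w.
apply: cmeasurableM; last exact: cmeasurable_cst.
by apply: cmeasurableM; [|apply: cmeasurable_conj]; exact: mc.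
Qed.

Lemma norm_Re_le (z : R[i]) : `|complex.Re z| <= complex.Re `|z|.
Proof.
case: z => a b; rewrite normc_def /= -sqrtr_sqr ler_wsqrtr //.
by rewrite lerDl sqr_ge0.
Qed.

Lemma norm_Im_le (z : R[i]) : `|complex.Im z| <= complex.Re `|z|.
Proof.
case: z => a b; rewrite normc_def /= -sqrtr_sqr ler_wsqrtr //.
by rewrite lerDr sqr_ge0.
Qed.

Lemma orbit_coef_le xi eta u : U u -> `|orbit_coef xi eta u| <= `|xi| * `|eta|.
Proof.
move=> [_ u1 u2]; apply: (le_trans (cauchy_schwarz (L2dotP L) _ _)).
rewrite ler_wpM2r // -(@ler_pXn2r _ 2) ?nnegrE // -!(dot_norm (L2dotP L)).
by rewrite dot_ract starK -ractM u1 ract1 dot_lact -lactM u1 lact1.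
Qed.

Definition cbounded (f : M -> R[i]) (B : R) :=
  forall u, U u -> `|complex.Re (f u)| <= B /\ `|complex.Im (f u)| <= B.

Lemma orbit_cbounded xi eta :
  cbounded (fun u => orbit_coef xi eta (E u)) (complex.Re (`|xi| * `|eta|)).
Proof.
move=> u Uu; have Du : D u by case: Uu.
have := orbit_coef_le xi eta Uu; rewrite Eid // lecE => /andP[_ h].
by split; apply: le_trans h; [exact: norm_Re_le | exact: norm_Im_le].
Qed.

Lemma cintegral_orbit xi eta :
  cintegral D mu (orbit_coef xi eta) =
  cintegral D mu (fun u => orbit_coef xi eta (E u)).
Proof.
by apply: eq_cintegral => u [Du _ _]; rewrite Eid.
Qed.

Lemma cintegralD f g B B' : cmeasurable f -> cmeasurable g ->
  cbounded f B -> cbounded g B' ->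
  cintegral D mu (fun u => f u + g u) = cintegral D mu f + cintegral D mu g.
Proof.
move=> [f1 f2] [g1 g2] fB gB; rewrite /cintegral.
have fi1 := bounded_integrable eP hD hE htauE mu f1 (fun u Uu => (fB u Uu).1).
have fi2 := bounded_integrable eP hD hE htauE mu f2 (fun u Uu => (fB u Uu).2).
have gi1 := bounded_integrable eP hD hE htauE mu g1 (fun u Uu => (gB u Uu).1).
have gi2 := bounded_integrable eP hD hE htauE mu g2 (fun u Uu => (gB u Uu).2).
have -> : \int[mu]_(u in U) complex.Re (f u + g u) =
    \int[mu]_(u in U) complex.Re (f u) + \int[mu]_(u in U) complex.Re (g u).
  by rewrite -RintegralD //; apply: eq_Rintegral => u _; rewrite raddfD.
have -> : \int[mu]_(u in U) complex.Im (f u + g u) =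
    \int[mu]_(u in U) complex.Im (f u) + \int[mu]_(u in U) complex.Im (g u).
  by rewrite -RintegralD //; apply: eq_Rintegral => u _; rewrite raddfD.
by rewrite !rmorphD /= mulrDr addrACA.
Qed.

Lemma cintegral_lmul f B v : U v -> cmeasurable f -> cbounded f B ->
  cintegral D mu (fun u => f (v * u)) = cintegral D mu f.
Proof.
move=> Uv [f1 f2] fB; rewrite /cintegral.
have h1 := haar_invariant eP hD hE htauE hmu Uv f1 (fun u Uu => (fB u Uu).1).
have h2 := haar_invariant eP hD hE htauE hmu Uv f2 (fun u Uu => (fB u Uu).2).
by rewrite -h1 -h2.
Qed.

Lemma cintegral_cst (c : R[i]) : cintegral D mu (fun=> c) = c.
Proof.
rewrite /cintegral !Rintegral_cst //=.
have -> : fine (mu U) = 1 by rewrite [mu _](hmu.1).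
by rewrite !mulr1 -complexiE -complexE.
Qed.

Lemma E_commE xi : E_comm D mu xi = commutant_proj blk e xi.
Proof.
have key : forall eta, dot (commutant_proj blk e xi) eta =
    cintegral D mu (orbit_coef xi eta).
  move=> eta.
  pose G eta := cintegral D mu (orbit_coef xi eta).
  have GD eta1 eta2 : G (eta1 + eta2) = G eta1 + G eta2.
    rewrite /G (cintegral_orbit xi (eta1 + eta2)) (cintegral_orbit xi eta1).
    rewrite (cintegral_orbit xi eta2).
    rewrite -(cintegralD (cmeasurable_orbit xi eta1) (cmeasurable_orbit xi eta2)
      (@orbit_cbounded xi eta1) (@orbit_cbounded xi eta2)).
    apply: eq_cintegral => u _.
    by rewrite /orbit_coef (dotDr (L2dotP L)).
  (* Moved to the first argument of the inner product, the conjugation becomes the left translation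
     of [u] to [v * u]. *)
  have Ginv v eta' : U v -> G (ract (lact (star v) eta') v) = G eta'.
    move=> Uv; rewrite /G (cintegral_orbit xi eta').
    rewrite -(cintegral_lmul Uv (cmeasurable_orbit xi eta') (@orbit_cbounded xi eta')).
    have DM := subalgebraM hD.1.
    apply: eq_cintegral => u [Du _ _]; case: Uv => Dv _ _.
    rewrite Eid; last exact: DM.
    rewrite /orbit_coef starM ractM lactM.
    by rewrite [in RHS]dot_ract starK -[in RHS]lact_ract [in RHS]dot_lact lact_ract.
  (* The projection of [eta] commutes with every [u], so after this replacement the integrand is
     constant. *)
  rewrite (dot_commutant_proj eP) -/(G eta) (invariant_proj eP hD GD Ginv).
  rewrite /G -[LHS]cintegral_cst.
  apply: eq_cintegral => u [Du u1 u2].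
  rewrite /orbit_coef dot_ract starK dot_lact.
  by rewrite -(commutant_proj_comm eP) // -lactM u1 lact1.
have ex : exists zeta : L, forall eta, dot zeta eta = cintegral D mu (orbit_coef xi eta).
  by exists (commutant_proj blk e xi).
apply: (dot_ext (L2dotP L)) => eta; rewrite key.
exact: (xgetPex 0 ex).
Qed.

End HaarAverage.

(** * Existence of the liberation derivation *)

(* The square-zero extension of A by the A-bimodule of tensors over D: a unital
   homomorphism a |-> (a, delta a) into it is the same thing as a derivation. *)
Section SquareZeroExtension.
Variables (R : realType) (M : tracialWstar R) (D A : set M).
Implicit Types s t : tensor M.

(** The second component is a whole class of formal sums, so that equality of elements is equality
    of tensors over [D]. *)
Record sqzero := SqZero {
  sq_base : M;
  sq_class : set (tensor M);
  sq_proof : A sq_base /\ exists2 s, tensor_in A s &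
    sq_class = [set t | tensor_in A t /\ tensor_eq D A s t]
}.

HB.instance Definition _ := gen_eqMixin sqzero.
HB.instance Definition _ := gen_choiceMixin sqzero.

Lemma sq_rep_exists (q : sqzero) : exists s, tensor_in A s /\
  sq_class q = [set t | tensor_in A t /\ tensor_eq D A s t].
Proof. by case: (sq_proof q) => _ [s hs hq]; exists s. Qed.

Definition sq_rep (q : sqzero) : tensor M := sval (cid (sq_rep_exists q)).

Lemma sq_rep_in q : tensor_in A (sq_rep q).
Proof. by rewrite /sq_rep; case: cid => s []. Qed.

Lemma sq_base_in q : A (sq_base q).
Proof. by case: (sq_proof q). Qed.

Lemma sq_mk_proof a s : A a -> tensor_in A s ->
  A a /\ exists2 s', tensor_in A s' &
    [set t | tensor_in A t /\ tensor_eq D A s t] =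
    [set t | tensor_in A t /\ tensor_eq D A s' t].
Proof. by move=> Aa As; split=> //; exists s. Qed.

Definition sq_mk a s (Aa : A a) (As : tensor_in A s) : sqzero :=
  SqZero (sq_mk_proof Aa As).

(** Independent of the chosen representative as soon as [b] is balanced. *)
Definition sq_eval (Z : zmodType) (b : M -> M -> Z) (q : sqzero) : Z :=
  \sum_(p <- sq_rep q) b p.1 p.2.

Lemma sq_eval_mk a s (Aa : A a) (As : tensor_in A s) (Z : zmodType) (b : M -> M -> Z) :
  balanced D A b -> sq_eval b (sq_mk Aa As) = \sum_(p <- s) b p.1 p.2.
Proof.
move=> bb; rewrite /sq_eval /sq_rep; case: cid => s' /= [hs' hq].
have : [set t | tensor_in A t /\ tensor_eq D A s t] s' by rewrite hq; split.
by move=> [_ /(_ Z b bb)].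
Qed.

(** Balanced maps separate classes by the very definition of [tensor_eq]; every algebra law below is
    proved by evaluating both sides. *)
Lemma sq_eq q r : sq_base q = sq_base r ->
  (forall (Z : zmodType) (b : M -> M -> Z), balanced D A b ->
     sq_eval b q = sq_eval b r) ->
  q = r.
Proof.
move=> qr h.
have hc : sq_class q = sq_class r.
  move: h; rewrite /sq_eval /sq_rep; case: cid => s /= [_ ->]; case: cid => t /= [_ ->] h.
  apply/seteqP; split=> u /= [Au hu]; split=> // Z b bb.
    by rewrite -hu // h.
  by rewrite -hu // h.
case: q r qr hc {h} => a c p [a' c' p'] /= aa' cc'; subst a' c'.
by congr SqZero; exact: Prop_irrelevance.
Qed.

Hypothesis hA : subalgebra A.
Hypothesis hD : subalgebra D.
Hypothesis hDA : D `<=` A.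

Lemma tensor_in_cat s t : tensor_in A s -> tensor_in A t -> tensor_in A (s ++ t).
Proof. by move=> hs ht p; rewrite mem_cat => /orP[/hs|/ht]. Qed.

Lemma tensor_in_tlact a s : A a -> tensor_in A s -> tensor_in A (tlact a s).
Proof.
move=> Aa hs _ /mapP[p /hs[p1 p2] ->]; split=> //=; exact: subalgebraM.
Qed.

Lemma tensor_in_tract a s : A a -> tensor_in A s -> tensor_in A (tract s a).
Proof.
move=> Aa hs _ /mapP[p /hs[p1 p2] ->]; split=> //=; exact: subalgebraM.
Qed.

Lemma tensor_in_nil : tensor_in A [::].
Proof. by []. Qed.

Lemma scalar_in (c : R[i]) : D c%:A.
Proof. by apply: subalgebraZ => //; exact: subalgebra1. Qed.

Lemma alg_in (c : R[i]) : A c%:A.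
Proof. exact: hDA (scalar_in c). Qed.

Definition sq_add q r := sq_mk (subalgebraD hA (sq_base_in q) (sq_base_in r))
  (tensor_in_cat (@sq_rep_in q) (@sq_rep_in r)).
Definition sq_zero := sq_mk (subalgebra0 hA) tensor_in_nil.
Definition sq_one := sq_mk (subalgebra1 hA) tensor_in_nil.
Definition sq_scale (c : R[i]) q := sq_mk (subalgebraM hA (alg_in c) (sq_base_in q))
  (tensor_in_tlact (alg_in c) (@sq_rep_in q)).
Definition sq_opp q := sq_scale (-1) q.
Definition sq_mul q r := sq_mk (subalgebraM hA (sq_base_in q) (sq_base_in r))
  (tensor_in_cat (tensor_in_tract (sq_base_in r) (@sq_rep_in q))
     (tensor_in_tlact (sq_base_in q) (@sq_rep_in r))).

Section Balanced.
Variables (Z : zmodType) (b : M -> M -> Z).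
Hypothesis bb : balanced D A b.

Lemma balanced_lmul a : A a -> balanced D A (fun x y => b (a * x) y).
Proof.
move=> Aa; have AM := subalgebraM hA; case: bb => b1 b2 b3; split.
- by move=> x x' y Ax Ax' Ay; rewrite mulrDr b1 //; exact: AM.
- by move=> x y y' Ax Ay Ay'; rewrite b2 //; exact: AM.
- by move=> x d y Ax Dd Ay; rewrite mulrA b3 //; exact: AM.
Qed.

Lemma balanced_rmul a : A a -> balanced D A (fun x y => b x (y * a)).
Proof.
move=> Aa; have AM := subalgebraM hA; case: bb => b1 b2 b3; split.
- by move=> x x' y Ax Ax' Ay; rewrite b1 //; exact: AM.
- by move=> x y y' Ax Ay Ay'; rewrite mulrDl b2 //; exact: AM.
- by move=> x d y Ax Dd Ay; rewrite -mulrA b3 //; exact: AM.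
Qed.

Lemma balanced_subl x x' y : A x -> A x' -> A y -> b (x - x') y = b x y - b x' y.
Proof.
move=> Ax Ax' Ay; case: bb => b1 b2 b3; apply: (addIr (b x' y)).
by rewrite -b1 ?subrK //; exact: (subalgebraB hA).
Qed.

Lemma balanced_0l y : A y -> b 0 y = 0.
Proof. by move=> Ay; rewrite -(subrr 1) balanced_subl ?subrr //; exact: (subalgebra1 hA). Qed.

Lemma balanced_oppl x y : A x -> A y -> b (- x) y = - b x y.
Proof.
move=> Ax Ay; have A0 := subalgebra0 hA.
by rewrite -[- x]sub0r balanced_subl // balanced_0l // sub0r.
Qed.

Lemma sq_eval_add q r : sq_eval b (sq_add q r) = sq_eval b q + sq_eval b r.
Proof. by rewrite sq_eval_mk // big_cat. Qed.

Lemma sq_eval_nil a (Aa : A a) : sq_eval b (sq_mk Aa tensor_in_nil) = 0.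
Proof. by rewrite sq_eval_mk // big_nil. Qed.

Lemma sq_eval_scale c q :
  sq_eval b (sq_scale c q) = sq_eval (fun x y => b (c%:A * x) y) q.
Proof. by rewrite sq_eval_mk // big_map. Qed.

Lemma sq_eval_mul q r : sq_eval b (sq_mul q r) =
  sq_eval (fun x y => b x (y * sq_base r)) q +
  sq_eval (fun x y => b (sq_base q * x) y) r.
Proof. by rewrite sq_eval_mk // big_cat !big_map. Qed.

Lemma sq_eval_sum (f g h : M -> M -> Z) q :
  (forall x y, A x -> A y -> f x y = g x y + h x y) ->
  sq_eval f q = sq_eval g q + sq_eval h q.
Proof.
move=> fgh; rewrite /sq_eval -big_split /= !big_seq; apply: eq_bigr => p /sq_rep_in[p1 p2].
exact: fgh.
Qed.

Lemma eq_sq_eval (f g : M -> M -> Z) q :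
  (forall x y, A x -> A y -> f x y = g x y) -> sq_eval f q = sq_eval g q.
Proof.
move=> fg; rewrite /sq_eval !big_seq; apply: eq_bigr => p /sq_rep_in[p1 p2].
exact: fg.
Qed.

End Balanced.

Lemma sq_addA : associative sq_add.
Proof.
move=> q r t; apply: sq_eq; first by rewrite /= addrA.
by move=> Z b bb; rewrite !sq_eval_add // addrA.
Qed.

Lemma sq_addC : commutative sq_add.
Proof.
move=> q r; apply: sq_eq; first by rewrite /= addrC.
by move=> Z b bb; rewrite !sq_eval_add // addrC.
Qed.

Lemma sq_add0 : left_id sq_zero sq_add.
Proof.
move=> q; apply: sq_eq; first by rewrite /= add0r.
by move=> Z b bb; rewrite sq_eval_add // sq_eval_nil // add0r.
Qed.

Lemma sq_addN : left_inverse sq_zero sq_opp sq_add.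
Proof.
move=> q; apply: sq_eq; first by rewrite /= scaleN1r mulN1r addNr.
move=> Z b bb; rewrite sq_eval_add // sq_eval_nil // sq_eval_scale //.
rewrite -(@sq_eval_sum _ (fun _ _ => 0)); first by rewrite /sq_eval big1.
by move=> x y Ax Ay; rewrite scaleN1r mulN1r (balanced_oppl bb) // addNr.
Qed.

Lemma sq_mulA : associative sq_mul.
Proof.
have AM := subalgebraM hA; have SB := @sq_base_in.
move=> q r t; apply: sq_eq; first by rewrite /= mulrA.
move=> Z b bb; rewrite !(sq_eval_mul bb) /=.
rewrite (sq_eval_mul (balanced_lmul bb (SB q))).
rewrite (sq_eval_mul (balanced_rmul bb (SB t))) addrA; congr (_ + _ + _).
- by apply: eq_sq_eval => x y _ _; rewrite mulrA.
- by apply: eq_sq_eval => x y _ _; rewrite mulrA.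
Qed.

Lemma sq_mul1 : left_id sq_one sq_mul.
Proof.
move=> q; apply: sq_eq; first by rewrite /= mul1r.
move=> Z b bb; rewrite (sq_eval_mul bb) /= sq_eval_nil; last first.
  exact: (balanced_rmul bb (@sq_base_in q)).
by rewrite add0r; apply: eq_sq_eval => x y _ _; rewrite mul1r.
Qed.

Lemma sq_1mul : right_id sq_one sq_mul.
Proof.
move=> q; apply: sq_eq; first by rewrite /= mulr1.
move=> Z b bb; rewrite (sq_eval_mul bb) /= [X in _ + X]sq_eval_nil; last first.
  exact: (balanced_lmul bb (@sq_base_in q)).
by rewrite addr0; apply: eq_sq_eval => x y _ _; rewrite mulr1.
Qed.

Lemma sq_mulDl : left_distributive sq_mul sq_add.
Proof.
have AM := subalgebraM hA; have SB := @sq_base_in.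
move=> q r t; apply: sq_eq; first by rewrite /= mulrDl.
move=> Z b bb; rewrite (sq_eval_mul bb) !(sq_eval_add bb) !(sq_eval_mul bb) /=.
rewrite (sq_eval_add (balanced_rmul bb (SB t))) -!addrA; congr (_ + _).
rewrite addrCA; congr (_ + _); apply: sq_eval_sum => x y Ax Ay.
by rewrite mulrDl; case: bb => h _ _; rewrite h //; exact: AM.
Qed.

Lemma sq_mulDr : right_distributive sq_mul sq_add.
Proof.
have AM := subalgebraM hA; have SB := @sq_base_in.
move=> q r t; apply: sq_eq; first by rewrite /= mulrDr.
move=> Z b bb; rewrite (sq_eval_mul bb) !(sq_eval_add bb) !(sq_eval_mul bb) /=.
rewrite (sq_eval_add (balanced_lmul bb (SB q))) addrACA; congr (_ + _).
apply: sq_eval_sum => x y Ax Ay.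
by rewrite mulrDr; case: bb => _ h _; rewrite h //; exact: AM.
Qed.

Lemma sq_one_neq0 : sq_one != sq_zero.
Proof.
by apply/eqP => /(congr1 (fun q => sq_base q)) /= /eqP; rewrite oner_eq0.
Qed.

Lemma sq_scaleA c d q : sq_scale c (sq_scale d q) = sq_scale (c * d) q.
Proof.
apply: sq_eq; first by rewrite /= mulrA [c%:A * _]mulr_algl scalerA.
move=> Z b bb; rewrite !(sq_eval_scale bb).
rewrite (sq_eval_scale (balanced_lmul bb (alg_in c))).
by apply: eq_sq_eval => x y _ _; rewrite mulrA [c%:A * _]mulr_algl scalerA.
Qed.

Lemma sq_scale1 : left_id 1 sq_scale.
Proof.
move=> q; apply: sq_eq; first by rewrite /= scale1r mul1r.
move=> Z b bb; rewrite (sq_eval_scale bb).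
by apply: eq_sq_eval => x y _ _; rewrite scale1r mul1r.
Qed.

Lemma sq_scaleDr : right_distributive sq_scale sq_add.
Proof.
move=> c q r; apply: sq_eq; first by rewrite /= mulrDr.
move=> Z b bb; rewrite (sq_eval_scale bb) (sq_eval_add bb) !(sq_eval_scale bb).
by rewrite (sq_eval_add (balanced_lmul bb (alg_in c))).
Qed.

Lemma sq_scaleDl q : {morph sq_scale^~ q : c d / c + d >-> sq_add c d}.
Proof.
have AM := subalgebraM hA.
move=> c d; apply: sq_eq; first by rewrite /= scalerDl mulrDl.
move=> Z b bb; rewrite (sq_eval_scale bb) (sq_eval_add bb) !(sq_eval_scale bb).
apply: sq_eval_sum => x y Ax Ay.
by rewrite scalerDl mulrDl; case: bb => h _ _; rewrite h //; apply: AM => //; exact: alg_in.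
Qed.

Lemma sq_scaleAl c q r : sq_scale c (sq_mul q r) = sq_mul (sq_scale c q) r.
Proof.
apply: sq_eq; first by rewrite /= mulrA.
move=> Z b bb; rewrite (sq_eval_scale bb) !(sq_eval_mul bb).
rewrite (sq_eval_mul (balanced_lmul bb (alg_in c))).
rewrite (sq_eval_scale (balanced_rmul bb (@sq_base_in r))); congr (_ + _).
by apply: eq_sq_eval => x y _ _; rewrite /= mulrA.
Qed.

Lemma sq_scaleAr c q r : sq_scale c (sq_mul q r) = sq_mul q (sq_scale c r).
Proof.
have comm (x : M) : x * c%:A = c%:A * x by rewrite mulr_algl -scalerAr mulr1.
have AM := subalgebraM hA; have SB := @sq_base_in.
apply: sq_eq; first by rewrite /= !mulrA comm.
move=> Z b bb; rewrite (sq_eval_scale bb) !(sq_eval_mul bb).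
rewrite (sq_eval_mul (balanced_lmul bb (alg_in c))).
rewrite (sq_eval_scale (balanced_lmul bb (SB q))); congr (_ + _).
  (* The scalar acts on the left tensor factor on one side and on the right factor on the other; it
     crosses the tensor sign because scalars lie in [D]. *)
  apply: eq_sq_eval => x y Ax Ay /=; rewrite mulrA comm -mulrA -comm.
  case: bb => _ _ h; rewrite h //; first exact: scalar_in.
  exact: AM.
by apply: eq_sq_eval => x y _ _; rewrite /= !mulrA comm.
Qed.

(** The operations depend on these three proofs, so the algebra structure is attached to a type that
    mentions them. *)
Definition sqalg (_ : subalgebra A) (_ : subalgebra D) (_ : D `<=` A) := sqzero.
Local Notation sq := (sqalg hA hD hDA).

HB.instance Definition _ := Choice.on sq.
HB.instance Definition _ := GRing.isZmodule.Build sq sq_addA sq_addC sq_add0 sq_addN.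
HB.instance Definition _ := GRing.Zmodule_isNzRing.Build sq
  sq_mulA sq_mul1 sq_1mul sq_mulDl sq_mulDr sq_one_neq0.
HB.instance Definition _ := GRing.Zmodule_isLmodule.Build R[i] sq
  sq_scaleA sq_scale1 sq_scaleDr sq_scaleDl.
HB.instance Definition _ := GRing.Lmodule_isLalgebra.Build R[i] sq sq_scaleAl.
HB.instance Definition _ := GRing.Lalgebra_isAlgebra.Build R[i] sq sq_scaleAr.

End SquareZeroExtension.

Section LiberationDerivation.
Variables (R : realType) (M : tracialWstar R) (D A1 A2 : set M).
Hypothesis hD : subalgebra D.
Hypothesis hD1 : D `<=` A1.
Hypothesis hfree : alg_free D A1 A2.

Local Notation A := (gen_alg (A1 `|` A2)).

Lemma gen_alg_subalgebra (S : set M) : subalgebra (gen_alg S).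
Proof.
split=> [B [B1 _ _] _ //|a x y Ax Ay B hB SB|x y Ax Ay B hB SB].
  by case: (hB) => _ h _; apply: h; [exact: Ax | exact: Ay].
by case: (hB) => _ _ h; apply: h; [exact: Ax | exact: Ay].
Qed.

Lemma gen_alg_sub (S : set M) : S `<=` gen_alg S.
Proof. by move=> x Sx B _; exact. Qed.

Let hA : subalgebra A := gen_alg_subalgebra _.
Let A1A : A1 `<=` A.
Proof. by move=> x hx; apply: gen_alg_sub; left. Qed.
Let A2A : A2 `<=` A.
Proof. by move=> x hx; apply: gen_alg_sub; right. Qed.
Let hDA : D `<=` A := subset_trans hD1 A1A.

Local Notation sq := (sqalg hA hD hDA).

Lemma commutator_tensor_in a : A a -> tensor_in A [:: (a, 1); (-1, a)].
Proof.
move=> Aa p; rewrite !inE => /orP[] /eqP -> /=; split=> //.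
  exact: subalgebra1.
by rewrite -sub0r; apply: (subalgebraB hA); [exact: subalgebra0 | exact: subalgebra1].
Qed.

(** Encodes the inner derivation given by the commutator with 1 (x) 1; the value [0] off the
    generated algebra only makes the function total. *)
Definition sq_left (a : M) : sq :=
  if pselect (A a) is left Aa then sq_mk D Aa (commutator_tensor_in Aa) else 0.
Definition sq_right (a : M) : sq :=
  if pselect (A a) is left Aa then sq_mk D Aa (@tensor_in_nil _ _ A) else 0.

Lemma sq_left_base a : A a -> sq_base (sq_left a) = a.
Proof. by rewrite /sq_left; case: pselect. Qed.

Lemma sq_right_base a : A a -> sq_base (sq_right a) = a.
Proof. by rewrite /sq_right; case: pselect. Qed.

Section Eval.
Variables (Z : zmodType) (b : M -> M -> Z).
Hypothesis bb : balanced D A b.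

Lemma sq_left_eval a : A a -> sq_eval b (sq_left a) = b a 1 - b 1 a.
Proof.
rewrite /sq_left; case: pselect => // Aa _; rewrite sq_eval_mk //.
rewrite big_cons big_seq1 /= (balanced_oppl hA bb) //; exact: subalgebra1.
Qed.

Lemma sq_right_eval a : A a -> sq_eval b (sq_right a) = 0.
Proof.
by rewrite /sq_right; case: pselect => // Aa _; rewrite sq_eval_nil.
Qed.

Lemma sq_eval_linear c (q r : sq) : sq_eval b (c *: q + r) =
  sq_eval (fun x y => b (c%:A * x) y) q + sq_eval b r.
Proof. by rewrite (sq_eval_add _ bb) (sq_eval_scale _ _ _ bb). Qed.

Lemma sq_eval_mulr (q r : sq) : sq_eval b (q * r) =
  sq_eval (fun x y => b x (y * sq_base r)) q +
  sq_eval (fun x y => b (sq_base q * x) y) r.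
Proof. exact: sq_eval_mul. Qed.

End Eval.

Lemma sq_baseD (c : R[i]) (q r : sq) :
  sq_base (c *: q + r) = c *: sq_base q + sq_base r.
Proof. by rewrite /= mulr_algl. Qed.

Lemma sq_left_hom : hom_on A1 sq_left.
Proof.
have A1' := subalgebra1 hA; have lin := subalgebraD hA; have AM := subalgebraM hA.
split.
- apply: sq_eq; first by rewrite sq_left_base.
  move=> Z b bb; rewrite (sq_left_eval bb) // subrr.
  by rewrite [RHS](sq_eval_nil bb).
- move=> c x y /A1A Ax /A1A Ay.
  have Ac : A (c *: x) by exact: (subalgebraZ hA).
  apply: sq_eq; first by rewrite sq_baseD !sq_left_base //; exact: lin.
  move=> Z b bb; rewrite (sq_eval_linear bb) (sq_left_eval bb); last exact: lin.
  rewrite (sq_left_eval bb) // (sq_left_eval (balanced_lmul hA bb (alg_in hD hDA c))) //.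
  case: bb => b1 b2 b3; rewrite b1 // b2 // mulr_algl mulr1.
  rewrite -[X in b 1 (X)]mulr_algl -b3 //; last exact: scalar_in.
  by rewrite mul1r opprD addrACA.
- move=> x y /A1A Ax /A1A Ay.
  apply: sq_eq; first by rewrite /= !sq_left_base //; exact: AM.
  move=> Z b bb; rewrite (sq_eval_mulr bb) (sq_left_eval bb); last exact: AM.
  rewrite !sq_left_base //.
  rewrite (sq_left_eval (balanced_lmul hA bb Ax)) //.
  rewrite (sq_left_eval (balanced_rmul hA bb Ay)) //.
  (* The two terms x (x) y cancel, as for every inner derivation. *)
  by rewrite mul1r mulr1 [RHS]addrC addrA subrK.
Qed.

Lemma sq_right_hom : hom_on A2 sq_right.
Proof.
have A1' := subalgebra1 hA; have lin := subalgebraD hA; have AM := subalgebraM hA.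
split.
- apply: sq_eq; first by rewrite sq_right_base.
  move=> Z b bb; rewrite (sq_right_eval bb) //.
  by rewrite [RHS](sq_eval_nil bb).
- move=> c x y /A2A Ax /A2A Ay.
  have Ac : A (c *: x) by exact: (subalgebraZ hA).
  apply: sq_eq; first by rewrite sq_baseD !sq_right_base //; exact: lin.
  move=> Z b bb; rewrite (sq_eval_linear bb) (sq_right_eval bb); last exact: lin.
  rewrite (sq_right_eval bb) // (sq_right_eval (balanced_lmul hA bb (alg_in hD hDA c))) //.
  by rewrite addr0.
- move=> x y /A2A Ax /A2A Ay.
  apply: sq_eq; first by rewrite /= !sq_right_base //; exact: AM.
  move=> Z b bb; rewrite (sq_eval_mulr bb) (sq_right_eval bb); last exact: AM.
  rewrite !sq_right_base //.
  by rewrite (sq_right_eval (balanced_lmul hA bb Ax)) //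
    (sq_right_eval (balanced_rmul hA bb Ay)) // addr0.
Qed.

(** Over [D] one has d (x) 1 = 1 (x) d; this is the compatibility required by the amalgam. *)
Lemma sq_left_right d : D d -> sq_left d = sq_right d.
Proof.
move=> Dd; have Ad := hDA Dd; apply: sq_eq; first by rewrite sq_left_base // sq_right_base.
move=> Z b bb; rewrite (sq_left_eval bb) // (sq_right_eval bb) //.
have := bb => -[_ _ /(_ 1 d 1)]; rewrite mul1r mulr1 => -> //; first exact: subrr.
  exact: subalgebra1.
exact: subalgebra1.
Qed.

Lemma liberation_derivation_exists : exists delta, is_liberation_derivation D A1 A2 delta.
Proof.
case: hfree => P [i1 [i2 [phi [[h1 h2 h12 univ] hphi phi1 phi2 phi_inj]]]].
have [g [[hg g1 g2] _]] := univ _ _ _ sq_left_hom sq_right_hom sq_left_right.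
have [gone glin gmul] := hg; have [pone plin pmul] := hphi.
have id_hom (S : set M) : hom_on S (id : M -> M) by [].
have [h [_ hu]] := univ M id id (id_hom A1) (id_hom A2) (fun x _ => erefl x).
(* Both sides extend the inclusions of [A1] and [A2] into [M], so the uniqueness clause of the
   universal property identifies them. *)
have base_g p : sq_base (g p) = phi p.
  have -> : phi = h by apply/esym/hu; split.
  suff -> : h = (fun p => sq_base (g p)) by [].
  apply: hu; split.
  - split; first by rewrite gone.
      by move=> a x y _ _; rewrite glin // sq_baseD.
    by move=> x y _ _; rewrite gmul.
  - by move=> x hx; rewrite g1 // sq_left_base //; exact: A1A.
  - by move=> x hx; rewrite g2 // sq_right_base //; exact: A2A.
have phi_onto a : A a -> exists p, phi p = a.
  move=> Aa; apply: (Aa [set a | exists p, phi p = a]).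
    split; first by exists 1.
      by move=> c _ _ [p <-] [q <-]; exists (c *: p + q); rewrite plin.
    by move=> _ _ [p <-] [q <-]; exists (p * q); rewrite pmul.
  by move=> x [hx|hx]; [exists (i1 x); rewrite phi1 | exists (i2 x); rewrite phi2].
pose delta (a : M) : tensor M :=
  if pselect (exists p, phi p = a) is left ex then sq_rep (g (sval (cid ex))) else [::].
(* Algebraic freeness enters here: as [phi] is injective, the preimage picked by [cid] is [p]
   itself. *)
have deltaE p : delta (phi p) = sq_rep (g p).
  rewrite /delta; case: pselect => [ex|]; last by case; exists p.
  by case: cid => q /= /phi_inj ->.
exists delta; split.
- by move=> a /phi_onto[p <-]; rewrite deltaE; exact: sq_rep_in.
- move=> c a b /phi_onto[p <-] /phi_onto[q <-] Z f ff.
  rewrite -plin // !deltaE glin // -/(sq_eval f _) (sq_eval_linear ff).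
  by rewrite big_cat big_map.
- move=> a b /phi_onto[p <-] /phi_onto[q <-] Z f ff.
  rewrite -pmul // !deltaE gmul // -/(sq_eval f _) (sq_eval_mulr ff) !base_g.
  by rewrite big_cat !big_map.
- move=> a ha Z f ff; rewrite -(phi1 a ha) deltaE phi1 // g1 //.
  rewrite -/(sq_eval f _) (sq_left_eval ff) ?big_cons ?big_nil ?addr0 /=; last exact: A1A.
  by rewrite (balanced_oppl hA ff) //; [exact: subalgebra1 | exact: A1A].
- move=> a ha Z f ff; rewrite -(phi2 a ha) deltaE g2 // -/(sq_eval f _).
  by rewrite (sq_right_eval ff) ?big_nil //; exact: A2A.
Qed.

End LiberationDerivation.

(** * Evaluation on words *)

Section Words.
Variables (R : realType) (M : tracialWstar R) (n : nat) (X : 'I_n -> M).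
Implicit Types (s : seq (M * 'I_n)) (u v b c : M) (f g : 'I_n -> M -> M -> R[i]).

(** The list form of [word], with the last coefficient kept apart, which permits structural
    induction. *)
Fixpoint lword s b : M := if s is (c, k) :: s' then c * X k * lword s' b else b.

(* Sum of f k x y over all ways to write u * lword s b as x * X k * y *)
Fixpoint cuts f u s b : R[i] :=
  if s is (c, k) :: s' then f k (u * c) (lword s' b) + cuts f (u * c * X k) s' b
  else 0.

Lemma lword_mulr s b v : lword s b * v = lword s (b * v).
Proof. by elim: s => //= -[c k] s IH; rewrite -mulrA IH. Qed.

Lemma lword_cat s c k s' b :
  lword (s ++ (c, k) :: s') b = lword s c * X k * lword s' b.
Proof. by elim: s => //= -[c' k'] s IH; rewrite IH !mulrA. Qed.

Lemma cuts_mull f u v s b :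
  cuts f (v * u) s b = cuts (fun k x y => f k (v * x) y) u s b.
Proof. by elim: s u => //= -[c k] s IH u; rewrite -!mulrA IH !mulrA. Qed.

Lemma cuts_mulr f u s b v :
  cuts f u s (b * v) = cuts (fun k x y => f k x (y * v)) u s b.
Proof. by elim: s u => //= -[c k] s IH u; rewrite IH lword_mulr. Qed.

Lemma cuts_rcons f u s c k b :
  cuts f u (rcons s (c, k)) b =
  cuts (fun k' x y => f k' x (y * X k * b)) u s c + f k (u * lword s c) b.
Proof.
elim: s u => [|[c' k'] s IH] u /=; first by rewrite addr0 add0r.
by rewrite IH addrA -cats1 lword_cat /= !mulrA.
Qed.

Lemma eq_cuts f g u s b : (forall k x y, f k x y = g k x y) ->
  cuts f u s b = cuts g u s b.
Proof. by move=> fg; elim: s u => //= -[c k] s IH u; rewrite fg IH. Qed.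

Lemma cutsB f g u s b :
  cuts f u s b - cuts g u s b = cuts (fun k x y => f k x y - g k x y) u s b.
Proof.
elim: s u => [|[c k] s IH] u /=; first by rewrite subrr.
by rewrite -IH opprD addrACA.
Qed.

Lemma cutsZ (a : R[i]) f u s b :
  a * cuts f u s b = cuts (fun k x y => a * f k x y) u s b.
Proof.
elim: s u => [|[c k] s IH] u /=; first by rewrite mulr0.
by rewrite -IH mulrDr.
Qed.

Lemma cuts_sum (I : finType) (F : I -> 'I_n -> M -> M -> R[i]) u s b :
  \sum_i cuts (F i) u s b = cuts (fun k x y => \sum_i F i k x y) u s b.
Proof.
elim: s u => [|[c k] s IH] u /=; first by rewrite big1.
by rewrite big_split /= IH.
Qed.

Variable B : set M.
Hypothesis hB : subalgebra B.

Definition letters s := forall p, p \in s -> B p.1.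

Lemma letters_cons c k s : letters ((c, k) :: s) <-> B c /\ letters s.
Proof.
split=> [h|[Bc hs] p]; last by rewrite inE => /orP[/eqP->|/hs].
by split=> [|p ps]; [apply: (h (c, k)); rewrite mem_head | apply: h; rewrite inE ps orbT].
Qed.

(** At the junction the last coefficient of one word merges with the first of the other, and the
    product stays in [B]. *)
Lemma lword_mul s b s' b' : letters s -> B b -> letters s' -> B b' ->
  exists s'' b'', [/\ letters s'', B b'' & lword s b * lword s' b' = lword s'' b''].
Proof.
move=> hs Bb hs' Bb'; case: s' hs' => [_|[c k] s' /letters_cons[Bc hs']].
  by exists s, (b * b'); split=> //; [exact: subalgebraM | rewrite lword_mulr].
exists (s ++ (b * c, k) :: s'), b'; split=> //.
  move=> p; rewrite mem_cat inE => /orP[/hs //|/orP[/eqP->|/hs' //]].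
  exact: subalgebraM.
by rewrite lword_cat -lword_mulr /= !mulrA.
Qed.

Definition linear_stable (V : set M) :=
  forall (a : R[i]) x y, V x -> V y -> V (a *: x + y).

(** The linear span as an intersection: a linear statement is proved on it by taking that statement
    as [V]. *)
Definition word_span : set M := [set a | forall V : set M, linear_stable V ->
  (forall s b, letters s -> B b -> V (lword s b)) -> V a].

Lemma word_span_subalgebra : subalgebra word_span.
Proof.
split=> [V _ hV|a x y hx hy V lV hV|x y hx hy V lV hV].
- by apply: (hV [::]) => //; exact: subalgebra1.
- by apply: (lV); [exact: (hx V lV hV) | exact: (hy V lV hV)].
- have h1 s b : letters s -> B b -> V (x * lword s b).
    move=> hs Bb; apply: (hx [set x | V (x * lword s b)]).
      by move=> a u v /= hu hv; rewrite mulrDl -scalerAl; exact: lV.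
    move=> s' b' hs' Bb' /=.
    have [s'' [b'' [hs'' Bb'' ->]]] := lword_mul hs' Bb' hs Bb.
    exact: hV.
  apply: (hy [set y | V (x * y)]) => //.
  by move=> a u v /= hu hv; rewrite mulrDr -scalerAr; exact: lV.
Qed.

Lemma gen_alg_word_span (D : set M) : D `<=` B ->
  gen_alg (gen_alg (D `|` range X) `|` B) `<=` word_span.
Proof.
move=> DB a Aa; apply: Aa; first exact: word_span_subalgebra.
have BW : B `<=` word_span by move=> b Bb V _ hV; exact: (hV [::]).
move=> x [hx|]; last exact: BW.
apply: hx; first exact: word_span_subalgebra.
move=> y [/DB/BW //|[k _ <-]] V _ hV.
have := hV [:: (1, k)] 1; rewrite /= mulr1 mul1r; apply.
  by apply/letters_cons; split=> //; exact: subalgebra1.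
exact: subalgebra1.
Qed.

End Words.

(** * Conjugate relations and the derivation on words *)

Section ConjugateWords.
Variables (R : realType) (M : tracialWstar R) (L : L2space M).
Variables (n : nat) (X : 'I_n -> M) (B : set M).
Hypothesis hB : subalgebra B.

Lemma word_mkseq (b : nat -> M) (k : nat -> 'I_n) l m :
  word X b k l (l + m) = lword X [seq (b t, k t) | t <- iota l m] (b (l + m)%N).
Proof.
elim: m l => [|m IH] l; first by rewrite /word addn0 big_geq //= mul1r.
rewrite /word big_ltn; last by rewrite addnS ltnS leq_addr.
by rewrite /= addnS -addSn -IH mulrA.
Qed.

Lemma cuts_mkseq f (b : nat -> M) (k : nat -> 'I_n) u l m :
  cuts X f u [seq (b t, k t) | t <- iota l m] (b (l + m)%N) =
  \sum_(l <= r < l + m)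
    f (k r) (u * word X b k l r) (word X b k r.+1 (l + m)).
Proof.
elim: m l u => [|m IH] l u; first by rewrite addn0 big_geq.
rewrite big_ltn; last by rewrite addnS ltnS leq_addr.
rewrite /= addnS -addSn -word_mkseq IH; congr (_ + _).
  by rewrite [word X b k l l]/word big_geq // mul1r.
apply: eq_big_nat => r /andP[lr _]; congr (f _ _ _).
by rewrite /word [in RHS]big_ltn // !mulrA.
Qed.

Variable J : 'I_n -> L.
Hypothesis hJ : is_conj_vars X B J.

Lemma conj_lword i s b : letters B s -> B b ->
  tau2 (ract (J i) (lword X s b)) =
  cuts X (fun k x y => (k == i)%:R * (tau x * tau y)) 1 s b.
Proof.
move=> hs Bb; have [_ /(_ (size s)) h] := hJ i.
(* The default [(b, i)] serves twice: [b' (size s)] is the final coefficient [b], and [b' t] lies in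
   [B] for every [t]. *)
pose b' t := (nth (b, i) s t).1; pose k' t := (nth (b, i) s t).2.
have hBt t : B (b' t).
  rewrite /b'; have [ts|ts] := ltnP t (size s); last by rewrite nth_default.
  by apply: hs; exact: mem_nth.
have sE : [seq (b' t, k' t) | t <- iota 0 (size s)] = s.
  rewrite -[RHS](mkseq_nth (b, i)); apply: eq_map => t.
  by rewrite /b' /k' -surjective_pairing.
have bE : b' (0 + size s)%N = b by rewrite /b' nth_default.
have := word_mkseq b' k' 0 (size s); rewrite sE bE => <-.
have := cuts_mkseq (fun k x y => (k == i)%:R * (tau x * tau y)) b' k' 1 0 (size s).
rewrite sE bE => ->; rewrite add0n (h b' k' hBt) big_mkcond.
by apply: eq_bigr => r _; rewrite mul1r; case: (_ == i); rewrite ?mul1r ?mul0r.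
Qed.

Definition cut_deriv (k : 'I_n) (x y : M) : R[i] :=
  tau (x * X k) * tau y - tau x * tau (X k * y).

Let xi := \sum_(i < n) comm2 (J i) (X i).

Lemma comm_lword s b : letters B s -> B b ->
  tau2 (ract xi (lword X s b)) = cuts X cut_deriv 1 s b.
Proof.
move=> hs Bb; rewrite ract_suml tau2_sum.
have B1 := subalgebra1 hB.
transitivity (\sum_i cuts X (fun k x y => (k == i)%:R *
    (tau (X i * x) * tau y - tau x * tau (y * X i))) 1 s b).
  apply: eq_bigr => i _.
  have -> : ract (comm2 (J i) (X i)) (lword X s b) =
      ract (J i) (X i * lword X s b) - lact (X i) (ract (J i) (lword X s b)).
    by rewrite ractDl ractNl -lact_ract -ractM.
  rewrite -scaleN1r tau2D tau2Z mulN1r tau2_trace -ractM.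
  have -> : X i * lword X s b = lword X ((1, i) :: s) b by rewrite /= mul1r.
  have -> : lword X s b * X i = lword X (rcons s (b, i)) 1.
    by rewrite -cats1 lword_cat /= mulr1.
  rewrite !conj_lword //; last first.
  - by apply/letters_cons.
  - by move=> p; rewrite mem_rcons inE => /orP[/eqP->|/hs].
  (* Cutting at the inserted [X i] contributes the trace of the whole word to both terms; these
     cancel and only the cuts inside the word remain. *)
  rewrite cuts_rcons [cuts _ _ 1 (_ :: _) _]/= eqxx !mul1r tau1 mul1r mulr1.
  rewrite [tau _ + cuts _ _ _ _ _]addrC [cuts _ _ 1 _ _ + _]addrC addrKA.
  rewrite -{1}[X i]mulr1 cuts_mull cutsB; apply: eq_cuts => k x y.
  by rewrite !mulr1 mulrBr.
rewrite cuts_sum; apply: eq_cuts => k x y.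
rewrite (bigD1 k) //= eqxx mul1r big1 ?addr0 => [|i ik]; last first.
  by rewrite eq_sym (negbTE ik) mul0r.
by rewrite /cut_deriv [tau (X k * x)]tau_trace [tau (y * X k)]tau_trace.
Qed.

(** The factors [u] and [v] are absorbed by the outer coefficients; in the empty word both meet in
    the single coefficient. The intended factors are the matrix units of [D]. *)
Lemma comm_lword_mul u v s b : letters B s -> B b -> B u -> B v ->
  tau2 (ract xi (u * lword X s b * v)) =
  cuts X (fun k x y => cut_deriv k (u * x) (y * v)) 1 s b.
Proof.
have BM := subalgebraM hB.
case: s => [|[c k] s] hs Bb Bu Bv.
  have -> : u * lword X [::] b * v = lword X [::] (u * b * v) by [].
  by rewrite comm_lword //; apply: (BM) => //; exact: BM.
have [Bc {}hs] := (letters_cons B c k s).1 hs.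
have -> : u * lword X ((c, k) :: s) b * v = lword X ((u * c, k) :: s) (b * v).
  by rewrite -lword_mulr /= !mulrA.
rewrite comm_lword //; last exact: BM.
  by rewrite cuts_mulr /= !mul1r lword_mulr -!mulrA cuts_mull.
by apply/letters_cons; split=> //; exact: BM.
Qed.

End ConjugateWords.

Section DerivationWords.
Variables (R : realType) (M : tracialWstar R).
Variables (n : nat) (X : 'I_n -> M) (B D : set M).
Hypothesis hB : subalgebra B.
Hypothesis hDB : D `<=` B.
Let A1 := gen_alg (D `|` range X).
Let A := gen_alg (A1 `|` B).
Variable delta : M -> tensor M.
Hypothesis hdelta : is_liberation_derivation D A1 B delta.

Let hA : subalgebra A := gen_alg_subalgebra _.

Lemma lword_in s b : letters B s -> B b -> A (lword X s b).
Proof.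
have AM := subalgebraM hA.
have BA : B `<=` A by move=> c Bc; apply: gen_alg_sub; right.
move=> + Bb; elim: s => [|[c k] s IH] /= => [_|/letters_cons[Bc /IH hs]]; first exact: BA.
apply: (AM) => //; apply: (AM); first exact: BA.
by apply: gen_alg_sub; left; apply: gen_alg_sub; right; exists k.
Qed.

Lemma derivation_lword (f : M -> M -> R[i]) s b : balanced D A f ->
  letters B s -> B b ->
  \sum_(p <- delta (lword X s b)) f p.1 p.2 =
  cuts X (fun k x y => f (x * X k) y - f x (X k * y)) 1 s b.
Proof.
have [_ _ dM dX dB] := hdelta.
have BA : B `<=` A by move=> c Bc; apply: gen_alg_sub; right.
have XA k : A (X k) by apply: gen_alg_sub; left; apply: gen_alg_sub; right; exists k.
have XA1 k : A1 (X k) by apply: gen_alg_sub; right; exists k.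
have AM := subalgebraM hA; have A1' := subalgebra1 hA.
(* The test map must vary in the induction: the Leibniz rule multiplies tensors on both sides, which
   is shifted onto [f]. *)
move=> + + Bb; elim: s f => [|[c k] s IH] f ff.
  by move=> _ /=; rewrite (dB b Bb _ _ ff) big_nil.
move=> /letters_cons[Bc hs]; have Ac := BA _ Bc.
have Aw := lword_in hs Bb; have AcX := AM _ _ Ac (XA k).
rewrite /= (dM _ _ AcX Aw _ _ ff) big_cat !big_map /=.
rewrite (IH _ (balanced_lmul hA ff AcX) hs).
have fw := balanced_rmul hA ff Aw.
rewrite (dM _ _ Ac (XA k) _ _ fw) big_cat !big_map /=.
rewrite (dB c Bc _ _ (balanced_rmul hA fw (XA k))) big_nil add0r.
rewrite (dX _ (XA1 k) _ _ (balanced_lmul hA fw Ac)) big_cons big_seq1 /=.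
rewrite !mul1r mulrN1 (balanced_oppl hA ff) //; last exact: AM.
congr (_ + _); rewrite -[in RHS](mulr1 (c * X k)) cuts_mull.
by apply: eq_cuts => k' x y; rewrite !mulrA.
Qed.

End DerivationWords.

(** * Closure properties of the generated L^2 space *)

Section GeneratedSpace.
Variables (R : realType) (M : tracialWstar R) (L : L2space M).
Implicit Types S : set M.

Lemma gen_vN_subalgebra S : subalgebra (gen_vN S).
Proof.
split=> [N [[N1 _ _] _] _ _ //|a x y hx hy N sN cN SN|x y hx hy N sN cN SN].
  by case: (sN) => -[_ h _] _; apply: h; [exact: hx | exact: hy].
by case: (sN) => -[_ _ h] _; apply: h; [exact: hx | exact: hy].
Qed.

Lemma gen_vN_sub S : S `<=` gen_vN S.
Proof. by move=> x Sx N _ _; exact. Qed.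

Lemma L2genP S (xi : L) : L2gen L S xi <->
  forall eps : R[i], 0 < eps -> exists2 x, gen_vN S x & `|xi - L2emb L x| < eps.
Proof.
split=> [h eps eps0|h Q].
  have [_ [[x Sx <-]]] := h (ball xi eps) (nbhsx_ballx xi eps eps0).
  by rewrite -ball_normE; exists x.
move=> /nbhs_ballP[eps /= eps0 sQ]; have [x Sx hx] := h eps eps0.
exists (L2emb L x); split; first by exists x.
by apply: sQ; rewrite -ball_normE.
Qed.

Lemma L2gen_mono S S' : S `<=` gen_vN S' -> L2gen L S `<=` L2gen L S'.
Proof.
move=> SS' xi /L2genP h; apply/L2genP => eps eps0.
have [x Sx hx] := h eps eps0; exists x => // N sN cN S'N.
by apply: Sx => // y /SS'; exact.
Qed.

Lemma L2gen_continuous S (F : L -> L) (f : M -> M) : continuous F ->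
  (forall x, F (L2emb L x) = L2emb L (f x)) ->
  (forall x, gen_vN S x -> gen_vN S (f x)) ->
  forall xi, L2gen L S xi -> L2gen L S (F xi).
Proof.
move=> cF Ff fS xi h Q nQ.
have [_ [[x Sx <-] hx]] := h (F @^-1` Q) (cF xi Q nQ).
exists (L2emb L (f x)); split; first by exists (f x) => //; exact: fS.
by rewrite -Ff.
Qed.

Lemma L2gen_lact S a xi : gen_vN S a -> L2gen L S xi -> L2gen L S (lact a xi).
Proof.
move=> Sa; apply: (L2gen_continuous (f := fun x => a * x)).
- exact: lact_continuous.
- by move=> x; rewrite lact_emb.
- by move=> x Sx; exact: subalgebraM (gen_vN_subalgebra S) _ _ Sa Sx.
Qed.

Lemma L2gen_ract S a xi : gen_vN S a -> L2gen L S xi -> L2gen L S (ract xi a).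
Proof.
move=> Sa; apply: (L2gen_continuous (F := fun u => ract u a) (f := fun x => x * a)).
- exact: ract_continuous.
- by move=> x; rewrite ract_emb.
- by move=> x Sx; exact: subalgebraM (gen_vN_subalgebra S) _ _ Sx Sa.
Qed.

Lemma L2gen0 S : L2gen L S 0.
Proof.
apply/L2genP => eps eps0; exists 0; first exact: subalgebra0 (gen_vN_subalgebra S).
by rewrite emb0 subrr normr0.
Qed.

Lemma L2genZ S (c : R[i]) xi : L2gen L S xi -> L2gen L S (c *: xi).
Proof.
move=> h; rewrite -[xi]lact1 -lactZl; apply: L2gen_lact => //.
apply: (subalgebraZ (gen_vN_subalgebra S)); exact: subalgebra1 (gen_vN_subalgebra S).
Qed.

Lemma L2genD S xi eta : L2gen L S xi -> L2gen L S eta -> L2gen L S (xi + eta).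
Proof.
move=> /L2genP h1 /L2genP h2; apply/L2genP => eps eps0.
have e2 : 0 < eps / 2 by rewrite divr_gt0.
have [x Sx hx] := h1 _ e2; have [y Sy hy] := h2 _ e2.
exists (x + y); first exact: subalgebraD (gen_vN_subalgebra S) _ _ Sx Sy.
rewrite embD opprD addrACA [eps]splitr.
exact: le_lt_trans (ler_normD _ _) (ltrD hx hy).
Qed.

Lemma L2gen_sum S (I : finType) (F : I -> L) :
  (forall i, L2gen L S (F i)) -> L2gen L S (\sum_i F i).
Proof. by move=> h; apply: big_ind => //; [exact: L2gen0 | exact: L2genD]. Qed.

End GeneratedSpace.

Lemma block_size_tag (k : nat) (m : 'I_k -> nat) (x : block_index m) :
  block_size (fun y : block_index m => tag y) x = m (tag x).
Proof.
rewrite /block_size -sum1_card.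
transitivity (\sum_(y : block_index m) (tag y == tag x : nat))%N.
  by rewrite big_mkcond.
rewrite -(sig_big_dep (fun=> true) (fun _ _ => true)
  (fun j (a : 'I_(m j)) => (j == tag x : nat))) /=.
rewrite (bigD1 (tag x)) //= [X in (_ + X)%N]big1 ?addn0 => [|j /negbTE jx].
  by rewrite eqxx sum_nat_const card_ord muln1.
by apply: big1 => a _; rewrite jx.
Qed.

(** Makes the trace of [EE E] depend only on the tensor class, so that the rules for [delta], valid
    up to [tensor_eq], can be applied inside it. *)
Lemma cond_exp_balanced (R : realType) (M : tracialWstar R) (D A : set M) (E : M -> M) :
  subalgebra D -> cond_exp D E ->
  balanced D A (fun x y => tau (E x * E y)).
Proof.
move=> hD hE; have [_ _ Elin _] := hE; have D1 := subalgebra1 hD.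
have ED x y : E (x + y) = E x + E y by have := Elin 1 x y; rewrite !scale1r.
split.
- by move=> x x' y _ _ _; rewrite ED mulrDl tauD.
- by move=> x y y' _ _ _; rewrite ED mulrDr tauD.
- by move=> x d y _ Dd _; rewrite (cond_expMr D1 hE _ Dd) (cond_expMl D1 hE _ Dd) mulrA.
Qed.

(** * The defining equation of the gradient *)

Section LiberationGradientFormula.
Variables (R : realType) (M : tracialWstar R) (L : L2space M).
Variables (n : nat) (X : 'I_n -> M) (B D : set M) (E : M -> M).
Hypothesis hB : star_subalgebra B.
Hypothesis hD : star_subalgebra D.
Hypothesis hDB : D `<=` B.
Hypothesis hE : cond_exp D E.
Hypothesis htauE : forall x, tau (E x) = tau x.
Variables (dimD : nat) (k : nat) (m : 'I_k -> nat).
Variable phi : (forall j, 'M[R[i]]_(m j)) -> M.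
Hypothesis hdim : has_dim D dimD.
Hypothesis hphi : is_block_iso D phi.
Local Notation e := (block_unit phi).
Local Notation blk := (fun x : block_index m => tag x).
Let eP : matrix_units D blk e := block_units hphi.

Lemma tau2_gradient (xi : L) a :
  tau2 (ract (dimD%:R *: ract (commutant_proj blk e xi) (block_c phi)^-1) a) =
  \sum_x \sum_y (wt e x)^-1 * tau2 (ract xi (e y x * a * e x y)).
Proof.
have [_ ->] := block_c_unit hphi hdim.
rewrite ractZl tau2Z -ractM ract_suml tau2_sum big_distrr /=.
apply: eq_bigr => x _; rewrite ract_suml tau2_sum big_distrr /=.
apply: eq_bigr => y _.
rewrite ractZl tau2Z -ractM -lact_ract tau2_trace -ractM.
rewrite (mulrA (e y x)) (mul_block_cinv hphi) -!scalerAl ractZr tau2Z !mulrA.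
congr (_ * _).
(* The factor [dimD], the inverse block size of the projection and the coefficient of the inverse of
   [block_c phi] combine to the inverse weight. *)
rewrite block_size_tag -mulrA.
have mx : (m (tag x))%:R != 0 :> R[i].
  by rewrite pnatr_eq0 -lt0n (block_size_gt0 hphi).
by rewrite mulrA divfK // invfM mulrA mulfV ?mul1r // (dim_neq0 hphi hdim x).
Qed.

Variable J : 'I_n -> L.
Hypothesis hJ : is_conj_vars X B J.
Let xi := \sum_(i < n) comm2 (J i) (X i).
Let j := dimD%:R *: ract (commutant_proj blk e xi) (block_c phi)^-1.
Let A1 := gen_alg (D `|` range X).
Let A := gen_alg (A1 `|` B).
Variable delta : M -> tensor M.
Hypothesis hdelta : is_liberation_derivation D A1 B delta.

Lemma tau_EE s : tau (EE E s) = \sum_(p <- s) tau (E p.1 * E p.2).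
Proof. exact: tau_sum. Qed.

Lemma gradient_trace a : A a -> tau2 (ract j a) = tau (EE E (delta a)).
Proof.
have hA : subalgebra A := gen_alg_subalgebra _.
have bal := cond_exp_balanced A hD.1 hE.
have [din dlin _ _ _] := hdelta.
have D1 := subalgebra1 hD.1.
move=> Aa; have := gen_alg_word_span hB.1 hDB Aa.
(* Membership in [A] is carried along because linearity of [delta] is only available there. *)
move=> /(_ [set a | A a /\ tau2 (ract j a) = tau (EE E (delta a))]) /= h.
apply: (h _ _).2 => [c x y [Ax hx] [Ay hy]|s b hs Bb].
  have hj : A (c *: x + y) by apply: (subalgebraD hA) => //; exact: (subalgebraZ hA).
  split=> //; rewrite ractDr ractZr tau2D tau2Z hx hy !tau_EE.
  rewrite (dlin c x y Ax Ay _ _ bal) big_cat big_map big_distrr /=; congr (_ + _).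
  apply: eq_bigr => p _.
  by rewrite (cond_expMl D1 hE _ (scalar_in hD.1 c)) -mulrA mulr_algl tauZ.
split; first exact: lword_in.
rewrite tau_EE (derivation_lword hdelta bal) // tau2_gradient.
(* As [D] lies in [B], a word flanked by matrix units is again a word with coefficients in [B], to
   which the conjugate relations apply. *)
have eB x y : B (e x y) by apply: hDB; exact: (mu_mem eP).
under eq_bigr => x _ do under eq_bigr => y _ do
  rewrite (comm_lword_mul hB.1 hJ hs Bb (eB y x) (eB x y)) cutsZ.
under eq_bigr => x _ do rewrite cuts_sum.
rewrite cuts_sum; apply: eq_cuts => l p q.
rewrite !(tau_cond_exp_mul eP D1 hE htauE) -sumrB; apply: eq_bigr => x _.
rewrite -sumrB; apply: eq_bigr => y _.
by rewrite -mulrBr /cut_deriv !mulrA.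
Qed.

Lemma gradient_expectation a : A a -> E2 E (ract j a) = L2emb L (EE E (delta a)).
Proof.
move=> Aa; have [_ _ dM _ dB] := hdelta.
have hA : subalgebra A := gen_alg_subalgebra _.
have BA : B `<=` A by move=> c Bc; apply: gen_alg_sub; right.
have D1 := subalgebra1 hD.1.
have bal := cond_exp_balanced A hD.1 hE.
apply: (E2_determined eP D1 hE htauE).
  rewrite /EE; apply: big_ind.
  - exact: subalgebra0 hD.1.
  - exact: subalgebraD hD.1.
  - by move=> p _; apply: (subalgebraM hD.1); case: hE.
move=> d Dd; have Ad := BA _ (hDB Dd).
rewrite -ractM gradient_trace; last exact: (subalgebraM hA).
(* Since [d] lies in [B], [delta d] vanishes, so [delta (a * d)] is [delta a] multiplied by [d] on
   the right; then [E] lets [d] out. *)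
rewrite tau_EE (dM _ _ Aa Ad _ _ bal) big_cat !big_map /=.
rewrite (dB d (hDB Dd) _ _ (balanced_lmul hA bal Aa)) big_nil addr0.
rewrite /EE big_distrl tau_sum; apply: eq_bigr => p _ /=.
by rewrite (cond_expMr D1 hE _ Dd) mulrA.
Qed.

Lemma gradient_L2gen : L2gen L (A1 `|` B) j.
Proof.
have [_ cE] := block_c_unit hphi hdim.
have sV := gen_vN_subalgebra (A1 `|` B).
have BV : B `<=` gen_vN (A1 `|` B) by move=> b Bb; apply: gen_vN_sub; right.
have eV x y : gen_vN (A1 `|` B) (e x y) by apply: BV; apply: hDB; exact: (mu_mem eP).
have XV i : gen_vN (A1 `|` B) (X i).
  by apply: gen_vN_sub; left; apply: gen_alg_sub; right; exists i.
apply: L2genZ; apply: L2gen_ract.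
  by rewrite cE; apply: (subalgebra_sum sV) => x; apply: (subalgebraZ sV).
apply: L2gen_sum => x; apply: L2gen_sum => y; apply: L2genZ.
apply: L2gen_ract => //; apply: L2gen_lact => //; apply: L2gen_sum => i.
have Ji : L2gen L (A1 `|` B) (J i).
  apply: (L2gen_mono _ (hJ i).1) => _ [[l _ <-]|/BV //]; exact: XV.
rewrite /comm2 -scaleN1r; apply: L2genD; first exact: L2gen_ract.
by apply: L2genZ; exact: L2gen_lact.
Qed.

End LiberationGradientFormula.

Theorem corollary5p9 (R : realType) (M : tracialWstar R) (L : L2space M)
    (n : nat) (X : 'I_n -> M) (B D : set M) (E : M -> M)
    (hB : star_subalgebra B)
    (hX : forall i, star (X i) = X i)
    (hPhi : (free_fisher L X B < +oo)%E)
    (hD : star_subalgebra D) (hDB : D `<=` B)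
    (hE : cond_exp D E) (htauE : forall x, tau (E x) = tau x)
    (hfree : alg_free (scalars (M := M)) (gen_alg (range X)) B)
    (hfreeD : alg_free D (gen_alg (D `|` range X)) B)
    (dimD : nat) (hdim : has_dim D dimD)
    (k : nat) (m : 'I_k -> nat) (phi : (forall j, 'M[R[i]]_(m j)) -> M)
    (hphi : is_block_iso D phi)
    (mu : probability (borelM L) R) (hmu : is_haar D mu) :
  block_c phi \is a GRing.unit /\
  is_liberation_gradient D (gen_alg (D `|` range X)) B E
    (dimD%:R *:
       ract (E_comm D mu (\sum_(i < n) comm2 (conj_vars L X B i) (X i)))
            (block_c phi)^-1).
Proof.
have hJ : is_conj_vars X B (conj_vars L X B).
  (* A finite value excludes the branch [+oo], so conjugate variables exist and the chosen ones
     satisfy the relations. *)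
  apply: xgetPex; move: hPhi; rewrite /free_fisher.
  by case: ifPn => [/asboolP //|_]; rewrite ltxx.
have hD1 : D `<=` gen_alg (D `|` range X).
  by move=> d Dd; apply: gen_alg_sub; left.
have [delta hdelta] := liberation_derivation_exists hD.1 hD1 hfreeD.
rewrite (E_commE (block_units hphi) hD hE htauE hmu).
split; first exact: (block_c_unit hphi hdim).1.
split; first exact: gradient_L2gen.
exists delta => // a Aa.
exact: (gradient_expectation hB hD hDB hE htauE hdim hphi hJ hdelta).
Qed.
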